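(* Let $\Gamma$ be a simply-laced Dynkin diagram of type $A,D,E$ with Coxeter number $h$. For all vertices $i,j$ of $\Gamma$ and all $l\ge0$ there is a quasi-isomorphism of complexes $A_{i,j;l}[2]\simeq A_{i,j;l+2h}$ (where $(C[2])^k=C^{k+2}$). In particular $H^{k+2}(A_{i,j;l})\cong H^k(A_{i,j;l+2h})$ for all $k$.
   Context: Fix a field $\mathbb K$. Let $\overline\Gamma$ be the double quiver of $\Gamma$ with arrows $e^{ij}\colon i\to j$ and $e^{ji}\colon j\to i$ for each edge $i - j$; fix $\epsilon(e^{ij})=-\epsilon(e^{ji})\in\{\pm1\}$; paths are composed right to left; $\theta_i=\sum_j\epsilon(e^{ij})e^{ji}e^{ij}$ (sum over neighbours $j$ of $i$). $A$ is the path algebra of $\overline\Gamma$ with adjoined generators $l_i$ ($i$ a vertex), $l_ie_j=e_jl_i=\delta_{ij}l_i$; it is spanned by words $p_1l_{i_1}p_2\cdots p_kl_{i_k}p_{k+1}$ with $p_a$ a path from $i_a$ to $i_{a-1}$. Arrows have length 1, each $l_i$ length 2, idempotents length 0. $A^{-k}_{i,j;l}$ is the span of such words going from $i$ to $j$ of total length $l$ with exactly $k$ letters $l$; $A_{i,j;l}$ is the complex with degree $-k$ term $A^{-k}_{i,j;l}$ and differential $d(p_1l_{i_1}\cdots p_kl_{i_k}p_{k+1})=\sum_{a=1}^k(-1)^{a+1}p_1l_{i_1}\cdots p_a\theta_{i_a}p_{a+1}\cdots l_{i_k}p_{k+1}$. (This is the Koszul complex of the preprojective algebra, graded by endpoints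 and length.) *)

(* Defs.v *)
From HB Require Import structures.
From mathcomp Require Import all_boot all_order all_algebra.
Set Implicit Arguments. Unset Strict Implicit. Unset Printing Implicit Defensive.
Import Order.TTheory GRing.Theory Num.Theory.
Local Open Scope ring_scope.

Inductive dynkin := TA of nat | TD of nat | TE6 | TE7 | TE8.

Definition dyn_rank (D : dynkin) : nat :=
  match D with TA m => m.+1 | TD m => m + 4 | TE6 => 6 | TE7 => 7 | TE8 => 8 end.

Definition coxeter (D : dynkin) : nat :=
  match D with
  | TA m => m.+2
  | TD m => 2 * (m + 4) - 2
  | TE6 => 12 | TE7 => 18 | TE8 => 30 end.

(* directed edges of the standard labelling, vertices 0..r-1:
   A_r : path 0-1-...-(r-1)
   D_r : path 0-1-...-(r-2), plus vertex r-1 joined to r-3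
   E_r : path 0-1-...-(r-2), plus vertex r-1 joined to 2 *)
Definition dyn_edge (D : dynkin) (x y : nat) : bool :=
  let r := dyn_rank D in
  match D with
  | TA _ => y == x.+1
  | TD _ => ((y == x.+1) && (y <= r - 2)%N) || ((x == r - 3) && (y == r - 1))
  | _ => ((y == x.+1) && (y <= r - 2)%N) || ((x == 2) && (y == r - 1))
  end%N.

Definition dyn_adj (D : dynkin) (x y : 'I_(dyn_rank D)) : bool :=
  dyn_edge D x y || dyn_edge D y x.
Arguments dyn_adj : clear implicits.

Record cplx (K : fieldType) := Cplx {
  cdim : int -> nat ;
  cd : forall p : int, 'M[K]_(cdim p, cdim (p + 1)) }.

Definition shift (K : fieldType) (C : cplx K) (s : int) : cplx K :=
  @Cplx K (fun p => cdim C (p + s))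
    (fun p => ((-1) ^+ `|s|%N) *:
       castmx (erefl, congr1 (cdim C) (addrAC p s 1)) (cd C (p + s))).

Definition chain_map (K : fieldType) (C D : cplx K)
  (f : forall p, 'M[K]_(cdim C p, cdim D p)) : Prop :=
  forall p : int, cd C p *m f (p + 1) = f p *m cd D p.

(* quasi-isomorphism: a chain map inducing bijections H^q(C) -> H^q(D) for all q
   (q = p + 1 below; cycles = kernel of d^q, boundaries = row space of d^(q-1) = d^p). *)
Definition quasi_iso (K : fieldType) (C D : cplx K) : Prop :=
  exists f : forall p, 'M[K]_(cdim C p, cdim D p),
    chain_map f /\
    (forall (p : int) (u : 'rV[K]_(cdim C (p + 1))),
        u *m cd C (p + 1) = 0 -> (u *m f (p + 1)%R <= cd D p)%MS -> (u <= cd C p)%MS) /\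
    (forall (p : int) (v : 'rV[K]_(cdim D (p + 1))),
        v *m cd D (p + 1) = 0 ->
        exists u : 'rV[K]_(cdim C (p + 1)),
          u *m cd C (p + 1) = 0 /\ (v - u *m f (p + 1)%R <= cd D p)%MS).

(* letter: inl (a,b) = arrow e^{ab} : a -> b ;  inr a = l_a *)
Definition letter (n : nat) := (('I_n * 'I_n) + 'I_n)%type.

Definition src n (x : letter n) : 'I_n := match x with inl p => p.1 | inr a => a end.
Definition tgt n (x : letter n) : 'I_n := match x with inl p => p.2 | inr a => a end.
Definition wt n (x : letter n) : nat := if x is inr _ then 2 else 1.
Definition isL n (x : letter n) : bool := if x is inr _ then true else false.
Definition okl n (e : rel 'I_n) (x : letter n) : bool :=
  if x is inl p then e p.1 p.2 else true.

(* words are written left to right; composition is right to left, so the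
   rightmost letter is applied first.  valid i j w : w is a word from i to j
   (the empty word is the idempotent e_i, from i to i). *)
Fixpoint valid n (i j : 'I_n) (w : seq (letter n)) : bool :=
  match w with
  | [::] => i == j
  | x :: w' => (tgt x == j) && valid i (src x) w'
  end.

Fixpoint seqs n (m : nat) : seq (seq (letter n)) :=
  if m is m'.+1 then [seq x :: w | x <- enum {: letter n}, w <- seqs n m']
  else [:: [::]].

(* basis of A^{-k}_{i,j;l}: words from i to j, total length l, exactly k letters l *)
Definition basis n (e : rel 'I_n) (i j : 'I_n) (l k : nat) : seq (seq (letter n)) :=
  [seq w <- flatten [seq seqs n m | m <- iota 0 l.+1] |
     [&& valid i j w, all (okl e) w, sumn (map (@wt n) w) == l
       & count (@isL n) w == k]].

Definition Bdeg n (e : rel 'I_n) (i j : 'I_n) (l : nat) (p : int) :=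
  if (p <= 0)%R then basis e i j l `|p|%N else [::].

Definition sgn (K : fieldType) (b : bool) : K := (-1) ^+ b.

(* d(w) as a formal list of (coefficient, word):
   d(p_1 l_{i_1} ... l_{i_k} p_{k+1}) = sum_a (-1)^(a+1) (... theta_{i_a} ...),
   theta_a = sum_{j ~ a} eps(e^{aj}) e^{ja} e^{aj}. *)
Fixpoint dterm (K : fieldType) n (e : rel 'I_n) (eps : 'I_n -> 'I_n -> bool)
    (w : seq (letter n)) : seq (K * seq (letter n)) :=
  match w with
  | [::] => [::]
  | (inl _ as x) :: w' => [seq (q.1, x :: q.2) | q <- dterm K e eps w']
  | (inr a as x) :: w' =>
      [seq (sgn K (eps a j), [:: inl (j, a); inl (a, j)] ++ w') | j <- enum 'I_n & e a j]
      ++ [seq (- q.1, x :: q.2) | q <- dterm K e eps w']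
  end.

Definition dcoef (K : fieldType) n (e : rel 'I_n) (eps : 'I_n -> 'I_n -> bool)
    (w v : seq (letter n)) : K :=
  \sum_(q <- dterm K e eps w) (if q.2 == v then q.1 else 0).

Definition Kcplx (K : fieldType) n (e : rel 'I_n) (eps : 'I_n -> 'I_n -> bool)
    (i j : 'I_n) (l : nat) : cplx K :=
  @Cplx K (fun p => size (Bdeg e i j l p))
    (fun p => \matrix_(r < size (Bdeg e i j l p), c < size (Bdeg e i j l (p + 1)))
        dcoef K e eps (nth [::] (Bdeg e i j l p) r) (nth [::] (Bdeg e i j l (p + 1)) c)).

(* Main.v *)
Require Import Defs.
From HB Require Import structures.
From mathcomp Require Import all_boot all_order all_algebra.
From mathcomp Require Import ring zify.
From Stdlib Require Import Classical ClassicalEpsilon.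
Set Implicit Arguments. Unset Strict Implicit. Unset Printing Implicit Defensive.
Import Order.TTheory GRing.Theory Num.Theory.
Local Open Scope ring_scope.

(** Passing to the dual complex, whose elements are functions on words, a cochain on
    words ending at j is a tuple of cochains at the neighbours of j (read off the words
    starting with an arrow into j) together with one at j (words starting with l_j).
    So the dual of A_{i,j;l} is the fibre of a "mesh" map from the sum over neighbours a of
    level l-1 to level l-2 at j: passing from one pair of consecutive levels to the next
    is a Bernstein-Gelfand-Ponomarev reflection of representations of the bipartite
    quiver.  Starting at the simple representation at i, every slice is a brick
    (its endomorphisms are scalars), so the mesh map is onto until the
    reflected slice becomes a simple representation at some vertex nu(i).
    Consequently the complexes are concentrated in degree 0 below that level, their
    dimensions are the entries of the Chebyshev matrices U_l(C) of the adjacency matrix C,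
    and the level at which this happens is read off one column of U_l(C); symmetry of
    U_l(C) shows that it is h-2 for all i and that nu is an involution.
    At level h there is thus a cycle u of degree -1 from i to nu(i) such that right
    multiplication by u is a quasi-isomorphism (induction on l through the fibre
    sequences); doing this twice gives the period 2h and the shift [2]. *)

(** * Linear algebra: separating functionals and annihilators *)

(** Gaussian elimination along [B], for a subspace given as a predicate: a member of [P] nonzero at
    the head is a pivot that clears this coordinate; without one, all of [P] vanishes there. *)
Lemma separating_functional (T : eqType) (F : fieldType) (B : seq T) (P : (T -> F) -> Prop) (x0 : T -> F) :
  uniq B -> P (fun=> 0) -> (forall p q c, P p -> P q -> P (fun t => p t + c * q t)) ->
  ~ (exists2 p, P p & {in B, p =1 x0}) ->
  exists2 u : T -> F, (forall p, P p -> \sum_(t <- B) u t * p t = 0)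
    & \sum_(t <- B) u t * x0 t != 0.
Proof.
elim: B P x0 => [|b B IHB] P x0 /=; first by move=> _ h0 _ []; exists (fun=> 0).
case/andP=> bB uB P0 Plin nx0.
have notb t : t \in B -> t != b by apply: contraTneq => ->.
have ext (u : T -> F) c x :
    \sum_(t <- b :: B) (if t == b then c else u t) * x t
    = c * x b + \sum_(t <- B) u t * x t.
  rewrite big_cons eqxx; congr (_ + _); rewrite !big_seq.
  by apply: eq_bigr => t /notb /negPf ->.
case: (classic (exists2 p, P p & p b != 0)) => [[p0 Pp0 p0b]|hb].
  pose red (p : T -> F) t := p t + (- (p b / p0 b)) * p0 t.
  pose P1 p := exists2 q, P q & forall t, p t = red q t.
  have [|||| u hu ux0] := IHB P1 (red x0) => //.
  - by exists (fun=> 0) => // t; rewrite /red mul0r oppr0 mul0r addr0.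
  - move=> p q c [p' Pp' hp] [q' Pq' hq]; exists (fun t => p' t + c * q' t); first exact: Plin.
    by move=> t; rewrite hp hq /red; ring.
  - case=> p [q Pq hp] hx; apply: nx0.
    exists (fun t => q t + ((x0 b - q b) / p0 b) * p0 t); first exact: Plin.
    move=> t; rewrite inE => /predU1P[->|tB]; first by rewrite divfK // addrC subrK.
    have := hx t tB; rewrite hp /red => /eqP; rewrite -subr_eq0 => /eqP hE.
    apply/eqP; rewrite -subr_eq0 -hE; apply/eqP.
    rewrite mulrBl; ring.
  have redE p : \sum_(t <- B) u t * red p t
      = - ((\sum_(t <- B) u t * p0 t) / p0 b) * p b + \sum_(t <- B) u t * p t.
    rewrite /red addrC; under eq_bigr do rewrite mulrDr.
    rewrite big_split /=; congr (_ + _).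
    transitivity (- (p b / p0 b) * \sum_(t <- B) u t * p0 t); last by ring.
    by rewrite mulr_sumr; apply: eq_bigr => t _; rewrite mulrCA.
  exists (fun t => if t == b then - ((\sum_(t <- B) u t * p0 t) / p0 b) else u t).
    by move=> p Pp; rewrite ext -redE; apply: hu; exists p.
  by rewrite ext -redE.
have pb p : P p -> p b = 0.
  by move=> Pp; apply/eqP; apply: contraT => h; case: hb; exists p.
have [x0b|x0b] := eqVneq (x0 b) 0; last first.
  exists (fun t => if t == b then 1 else 0) => [p Pp|].
    by rewrite (ext (fun=> 0)) pb // mulr0 add0r big1 // => t _; rewrite mul0r.
  by rewrite (ext (fun=> 0)) mul1r big1 ?addr0 // => t _; rewrite mul0r.
have [|u hu ux0] := IHB P x0 uB P0 Plin.
  case=> p Pp hp; apply: nx0; exists p => // t.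
  by rewrite inE => /predU1P[->|/hp //]; rewrite x0b pb.
exists (fun t => if t == b then 0 else u t) => [p Pp|]; rewrite ext mul0r add0r //.
exact: hu.
Qed.

Lemma predS (m : nat) : m.+1%:Z - 1 = m%:Z. Proof. lia. Qed.

Lemma pred2S (m : nat) : m.+2%:Z - 2 = m%:Z. Proof. lia. Qed.

Lemma two_step (P : nat -> Prop) :
  P 0%N -> P 1%N -> (forall m, P m -> P m.+1 -> P m.+2) -> forall m, P m.
Proof.
move=> h0 h1 h m; suff [] : P m /\ P m.+1 by [].
by elim: m => [|m [? ?]]; split=> //; apply: h.
Qed.

Lemma mul_row_kermx_tr (K : fieldType) p q (A : 'M[K]_(p, q)) (r : 'I_q) :
  A *m (row r (kermx A^T))^T = 0.
Proof. by apply: trmx_inj; rewrite trmx_mul trmxK -row_mul mulmx_ker row0 trmx0. Qed.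

(** Double annihilator. It turns claims on chains, which are rows, into claims on cochains, which
    are columns. *)
Lemma submx_cols (K : fieldType) m1 m2 p (A : 'M[K]_(m1, p)) (B : 'M[K]_(m2, p)) :
  (forall y : 'cV_p, B *m y = 0 -> A *m y = 0) -> (A <= B)%MS.
Proof.
move=> hy; rewrite submxE; apply/eqP/matrixP => r c.
have : A *m (cokermx B *m delta_mx c (0 : 'I_1)) = 0.
  by apply: hy; rewrite mulmxA mulmx_coker mul0mx.
by rewrite mulmxA -colE => /colP/(_ r); rewrite mxE [in RHS]mxE => ->; rewrite mxE.
Qed.

Lemma kermx_annihilator (K : fieldType) m1 p (A : 'M[K]_(m1, p)) (x : 'cV_m1) :
  kermx A *m x = 0 -> exists z : 'cV_p, x = A *m z.
Proof.
move=> hx; have /submxP[z hz] : (x^T <= A^T)%MS.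
  apply: submx_cols => y hy; apply: trmx_inj; rewrite trmx_mul trmxK trmx0.
  have /submxP[w ->] : (y^T <= kermx A)%MS.
    by rewrite sub_kermx; apply/eqP/trmx_inj; rewrite trmx_mul trmxK hy trmx0.
  by rewrite -mulmxA hx mulmx0.
by exists z^T; apply: trmx_inj; rewrite trmx_mul trmxK.
Qed.

(** * Words and the dual complex *)

Section Words.
Variables (n : nat) (e : rel 'I_n).
Hypothesis e_sym : symmetric e.
Implicit Types (w v : seq (letter n)) (i j a b : 'I_n) (l k : int).

Definition wtotal w : nat := sumn (map (@wt n) w).

(* Lengths and degrees are integers, so that the recursion on words needs no truncated subtraction. *)
Definition word i j l k w : bool :=
  [&& valid i j w, all (okl e) w, (wtotal w)%:Z == l & (count (@isL n) w)%:Z == k].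

Lemma word_nil i j l k : word i j l k [::] = [&& i == j, l == 0 & k == 0].
Proof. by rewrite /word /= ![0%:Z == _]eq_sym. Qed.

Lemma word_arrow i j l k a b w :
  word i j l k (inl (a, b) :: w) = [&& b == j, e a b & word i a (l - 1) k w].
Proof.
rewrite /word /wtotal /= PoszD add0n.
have -> (x : int) : (1%:Z + x == l) = (x == l - 1).
  by rewrite [RHS]eq_sym subr_eq eq_sym addrC.
by case: (b == j); case: (e a b); case: (valid i a w); case: (all _ w).
Qed.

Lemma word_loop i j l k b w :
  word i j l k (inr b :: w) = (b == j) && word i j (l - 2) (k - 1) w.
Proof.
rewrite /word /wtotal /= !PoszD.
have E (c x y : int) : (c + x == y) = (x == y - c).
  by rewrite [RHS]eq_sym subr_eq eq_sym addrC.
rewrite !E /=.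
by case: eqP => // ->; case: (valid i j w).
Qed.

Lemma word_cat i i' j l l' k k' w v :
  word i' j l k w -> word i i' l' k' v -> word i j (l + l') (k + k') (w ++ v).
Proof.
elim: w j l k => [|[[a b]|b] w IHw] j l k /=.
- by rewrite word_nil => /and3P[/eqP <- /eqP -> /eqP ->]; rewrite !add0r.
- rewrite !word_arrow => /and3P[-> -> hw] hv /=.
  by rewrite (_ : l + l' - 1 = l - 1 + l'); [apply: IHw | ring].
- rewrite !word_loop => /andP[-> hw] hv /=.
  rewrite (_ : l + l' - 2 = l - 2 + l'); last by ring.
  rewrite (_ : k + k' - 1 = k - 1 + k'); last by ring.
  exact: IHw.
Qed.

Lemma word_ge0 i j l k w : word i j l k w -> 0 <= l /\ 0 <= k.
Proof. by case/and4P=> _ _ /eqP <- /eqP <-. Qed.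

Lemma mem_seqs m w : (w \in seqs n m) = (size w == m).
Proof.
elim: m w => [|m IHm] w /=; first by rewrite inE size_eq0.
apply/allpairsP/idP => [[[x v] /= [_ + ->]]|]; first by rewrite IHm.
by case: w => // x w; rewrite eqSS -IHm => hw; exists (x, w); rewrite mem_enum.
Qed.

Lemma seqs_uniq m : uniq (seqs n m).
Proof.
elim: m => //= m IHm; apply: allpairs_uniq => //; first exact: enum_uniq.
by move=> [x v] [y u] _ _ /= [-> ->].
Qed.

Lemma leq_size_wtotal w : (size w <= wtotal w)%N.
Proof.
by elim: w => //= x w IHw; rewrite /wtotal /= -/(wtotal w); case: x => * /=; lia.
Qed.

Lemma mem_basis i j (l k : nat) w : (w \in basis e i j l k) = word i j l k w.
Proof.
rewrite mem_filter /word !eqz_nat -/(wtotal w) andb_idr //.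
case/and4P=> _ _ /eqP hl _; apply/flatten_mapP; exists (size w).
  by rewrite mem_iota add0n /= ltnS -hl leq_size_wtotal.
by rewrite mem_seqs.
Qed.

Lemma basis_uniq i j (l k : nat) : uniq (basis e i j l k).
Proof.
apply: filter_uniq; elim: l.+1 0%N => //= m IHm s.
rewrite cat_uniq seqs_uniq IHm andbT; apply/hasPn => w /flatten_mapP[t].
rewrite mem_iota !mem_seqs => /andP[hs _] /eqP ->.
by apply/negP => /eqP hst; rewrite hst ltnn in hs.
Qed.

Definition words i j l k : seq (seq (letter n)) :=
  if (0 <= l) && (0 <= k) then basis e i j `|l|%N `|k|%N else [::].

Lemma mem_words i j l k w : (w \in words i j l k) = word i j l k w.
Proof.
rewrite /words; case: ifP => [/andP[hl hk]|h]; first by rewrite mem_basis !gez0_abs.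
by apply/esym/negP => /word_ge0[hl hk]; rewrite hl hk in h.
Qed.

Lemma words_uniq i j l k : uniq (words i j l k).
Proof. by rewrite /words; case: ifP => // _; apply: basis_uniq. Qed.

Variable K : fieldType.
Variable eps : 'I_n -> 'I_n -> bool.
Implicit Types (phi psi : seq (letter n) -> K) (Phi : 'I_n -> seq (letter n) -> K).

(* The transpose of the differential: (bdry phi)(w) = phi(d w). *)
Definition bdry phi w : K := \sum_(q <- dterm K e eps w) q.1 * phi q.2.

Definition after (x : letter n) phi w : K := phi (x :: w).

Definition parts phi (j : 'I_n) : 'I_n -> seq (letter n) -> K :=
  fun a => after (inl (a, j)) phi.

(* phi |-> phi(theta_j w), where Phi a is the part of phi on words starting with e^{aj}. *)
Definition mesh (j : 'I_n) Phi w : K :=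
  \sum_(a | e j a) sgn K (eps j a) * Phi a (inl (j, a) :: w).

(** Assembles a cochain from its arrow parts and its loop part. The endpoint [j] is not stored,
    since a cochain matters only on words ending at a fixed vertex. *)
Definition glue Phi psi w : K :=
  match w with
  | [::] => 0
  | inl p :: w' => Phi p.1 w'
  | inr _ :: w' => psi w'
  end.

Lemma bdry_nil phi : bdry phi [::] = 0.
Proof. exact: big_nil. Qed.

Lemma bdry_arrow phi p w : bdry phi (inl p :: w) = bdry (after (inl p) phi) w.
Proof. by rewrite /bdry /= big_map. Qed.

Lemma bdry_loop phi j w :
  bdry phi (inr j :: w) = mesh j (parts phi j) w - bdry (after (inr j) phi) w.
Proof.
rewrite /bdry /= big_cat /= !big_map; congr (_ + _).
  by rewrite /mesh big_filter big_enum_cond; apply: eq_bigl => a; rewrite inE.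
by rewrite -sumrN; apply: eq_bigr => q _; rewrite mulNr.
Qed.

Lemma mem_dterm i j l k w q :
  q \in dterm K e eps w -> word i j l k w -> word i j l (k - 1) q.2.
Proof.
elim: w j l k q => [|[[a b]|b] w IHw] j l k q //=.
  move=> /mapP[q' hq' ->]; rewrite !word_arrow => /and3P[-> -> hw] /=.
  exact: IHw hq' hw.
rewrite mem_cat word_loop => /orP[/mapP[a]|/mapP[q' hq' ->]] /=; last first.
  by case/andP=> hb hw; rewrite word_loop hb /=; apply: IHw hq' hw.
rewrite mem_filter => /andP[hba _] -> /andP[/eqP ejb hw]; subst b.
rewrite !word_arrow !eqxx /= e_sym hba /=.
by rewrite (_ : l - 1 - 1 = l - 2) //; ring.
Qed.

Lemma eq_bdry i j l k phi psi :
  (forall w, word i j l (k - 1) w -> phi w = psi w) ->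
  forall w, word i j l k w -> bdry phi w = bdry psi w.
Proof.
move=> E w hw; rewrite /bdry !big_seq; apply: eq_bigr => q hq.
by rewrite E //; apply: mem_dterm hq hw.
Qed.

Lemma bdry0 i j l phi w : word i j l 0 w -> bdry phi w = 0.
Proof.
move=> hw; transitivity (bdry (fun=> 0 : K) w); last first.
  by apply: big1_seq => q _; rewrite mulr0.
by apply: (eq_bdry _ hw) => v /word_ge0[_]; rewrite sub0r.
Qed.

Lemma bdry_lin phi psi c w :
  bdry (fun v => phi v + c * psi v) w = bdry phi w + c * bdry psi w.
Proof.
rewrite /bdry mulr_sumr -big_split /=; apply: eq_bigr => q _.
by rewrite mulrDr !mulrA [q.1 * c]mulrC.
Qed.

Lemma bdryB phi psi w : bdry (fun v => phi v - psi v) w = bdry phi w - bdry psi w.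
Proof.
rewrite -[RHS]addr0 -mulN1r addr0 -bdry_lin.
by apply: eq_bigr => q _; rewrite mulN1r.
Qed.

Lemma bdryN psi w : bdry (fun v => - psi v) w = - bdry psi w.
Proof. by rewrite /bdry -sumrN; apply: eq_bigr => q _; rewrite mulrN. Qed.

Lemma bdry_zero w : bdry (fun=> 0) w = 0.
Proof. by apply: big1_seq => q _; rewrite mulr0. Qed.

Lemma bdry_sum (I : finType) (P : pred I) (c : I -> K) (F : I -> seq (letter n) -> K) w :
  bdry (fun v => \sum_(i | P i) c i * F i v) w = \sum_(i | P i) c i * bdry (F i) w.
Proof.
rewrite /bdry; under eq_bigr do rewrite mulr_sumr.
rewrite exchange_big /=; apply: eq_bigr => i _; rewrite mulr_sumr.
by apply: eq_bigr => q _; rewrite mulrCA.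
Qed.

Lemma bdry_mesh j Phi w : bdry (mesh j Phi) w = mesh j (fun a => bdry (Phi a)) w.
Proof.
rewrite /mesh (bdry_sum _ _ (fun a v => Phi a (inl (j, a) :: v))).
by apply: eq_bigr => a _; rewrite bdry_arrow.
Qed.

Lemma meshB j Phi Psi w :
  mesh j (fun a v => Phi a v - Psi a v) w = mesh j Phi w - mesh j Psi w.
Proof. by rewrite /mesh -sumrB; apply: eq_bigr => a _; rewrite mulrBr. Qed.

Lemma mesh_lin j Phi Psi c w :
  mesh j (fun a v => Phi a v + c * Psi a v) w = mesh j Phi w + c * mesh j Psi w.
Proof.
rewrite /mesh mulr_sumr -big_split; apply: eq_bigr => a _.
by rewrite mulrDr mulrCA.
Qed.

Lemma eq_mesh i j l k Phi Psi :
  (forall a v, e a j -> word i a (l + 1) k v -> Phi a v = Psi a v) ->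
  forall w, word i j l k w -> mesh j Phi w = mesh j Psi w.
Proof.
move=> E w hw; apply: eq_bigr => a eja; congr (_ * _).
by apply: E; [rewrite e_sym | rewrite word_arrow eqxx eja addrK].
Qed.

(** The two mixed terms cancel: [mesh] only involves prepended arrows, which carry no sign in d, so
    it commutes with [bdry]. *)
Lemma bdry_bdry phi w : bdry (bdry phi) w = 0.
Proof.
elim: w phi => [|[p|j] w IHw] phi; first exact: bdry_nil.
  rewrite bdry_arrow -[RHS](IHw (after (inl p) phi)).
  by apply: eq_bigr => q _; rewrite /after bdry_arrow.
rewrite bdry_loop.
have -> : bdry (after (inr j) (bdry phi)) w
    = bdry (fun v => mesh j (parts phi j) v - bdry (after (inr j) phi) v) w.
  by apply: eq_bigr => q _; rewrite /after bdry_loop.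
rewrite bdryB IHw subr0 bdry_mesh; apply/eqP; rewrite subr_eq0; apply/eqP.
by apply: eq_bigr => a _; rewrite /parts /after bdry_arrow.
Qed.

(** * Cocycles, exactness and the fibre sequences *)

Definition eqon i j l k phi psi := forall w, word i j l k w -> phi w = psi w.

Definition cocycle i j l k phi := forall w, word i j l (k + 1) w -> bdry phi w = 0.

(** By [bdry0], in degree 0 this says that every cocycle is zero on the words. *)
Definition exactAt i j l k :=
  forall phi, cocycle i j l k phi -> exists psi, eqon i j l k phi (bdry psi).

Lemma choose_adj j (P : 'I_n -> (seq (letter n) -> K) -> Prop) :
  (forall a, e a j -> exists phi, P a phi) ->
  exists Phi, forall a, e a j -> P a (Phi a).
Proof.
move=> h; apply: (@fin_all_exists _ _ (fun a phi => e a j -> P a phi)) => a.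
case: (boolP (e a j)) => [/h[phi hphi]|_]; first by exists phi.
by exists (fun=> 0).
Qed.

Lemma cocycle_lin i j l k phi psi c :
  cocycle i j l k phi -> cocycle i j l k psi ->
  cocycle i j l k (fun w => phi w + c * psi w).
Proof. by move=> h1 h2 w hw; rewrite bdry_lin h1 ?h2 // mulr0 addr0. Qed.

Lemma cocycle_zero i j l k : cocycle i j l k (fun=> 0).
Proof. by move=> w _; rewrite bdry_zero. Qed.

Lemma cocycleZ i j l k phi c :
  cocycle i j l k phi -> cocycle i j l k (fun w => c * phi w).
Proof.
move=> h w hw; rewrite -[RHS](mulr0 c) -(h _ hw) /bdry mulr_sumr.
by apply: eq_bigr => q _; rewrite mulrCA.
Qed.

Lemma eqon_cocycle i j l k phi psi :
  eqon i j l k phi psi -> cocycle i j l k phi -> cocycle i j l k psi.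
Proof.
move=> E h w hw; rewrite -(h _ hw); apply/esym.
by apply: (eq_bdry _ hw) => v; rewrite addrK; apply: E.
Qed.

Lemma cocycle_parts i j l k phi a :
  cocycle i j l k phi -> e a j -> cocycle i a (l - 1) k (parts phi j a).
Proof.
move=> h ea w hw; rewrite -(h (inl (a, j) :: w)) ?bdry_arrow //.
by rewrite word_arrow eqxx ea.
Qed.

Lemma cocycle_after_loop i j l k phi :
  cocycle i j l k phi ->
  eqon i j (l - 2) k (mesh j (parts phi j)) (bdry (after (inr j) phi)).
Proof.
move=> h w hw; apply/eqP; rewrite -subr_eq0 -bdry_loop h //.
by rewrite word_loop eqxx addrK.
Qed.

(** Converse of [cocycle_parts] and [cocycle_after_loop]: a cocycle at j is a family of cocycles at
    the neighbours together with a null-homotopy [psi] of its mesh. *)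
Lemma cocycle_glue i j l k Phi psi :
  (forall a, e a j -> cocycle i a (l - 1) k (Phi a)) ->
  eqon i j (l - 2) k (mesh j Phi) (bdry psi) -> cocycle i j l k (glue Phi psi).
Proof.
move=> h1 h2 [|[[a b]|b] w]; first by rewrite bdry_nil.
  rewrite word_arrow bdry_arrow => /and3P[/eqP eb ea hw].
  by subst b; apply: h1 ea _ hw.
rewrite word_loop bdry_loop addrK => /andP[/eqP -> /h2 <-].
by apply/eqP; rewrite subr_eq0.
Qed.

Lemma cocycle_mesh i j l k Phi :
  (forall a, e a j -> cocycle i a (l + 1) k (Phi a)) ->
  cocycle i j l k (mesh j Phi).
Proof.
move=> h w hw; rewrite bdry_mesh.
rewrite (eq_mesh (Psi := fun _ _ => 0) _ hw) => [|a v ea /(h _ ea) //].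
by apply: big1 => a _; rewrite mulr0.
Qed.

Lemma bdry_glue i j l k Phi psi phi :
  ~~ word i j l k [::] ->
  (forall a, e a j -> eqon i a (l - 1) k (parts phi j a) (bdry (Phi a))) ->
  (forall w, word i j (l - 2) (k - 1) w ->
     after (inr j) phi w = mesh j Phi w - bdry psi w) ->
  eqon i j l k phi (bdry (glue Phi psi)).
Proof.
move=> h0 h1 h2 [|[[a b]|b] w]; first by rewrite (negPf h0).
  rewrite word_arrow bdry_arrow => /and3P[/eqP eb ea hw].
  by subst b; apply: h1.
by rewrite word_loop bdry_loop => /andP[/eqP -> /h2 <-].
Qed.

(** Long exact sequence of the fibre: H^k on level l at j sits between H^(k-1) on level l-2 at j and
    the H^k on level l-1 at the neighbours. The empty word has no first letter, so the fibre does
    not see it. *)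
Lemma exact_step i j l k :
  (forall a, e a j -> exactAt i a (l - 1) k) -> exactAt i j (l - 2) (k - 1) ->
  ~~ word i j l k [::] -> exactAt i j l k.
Proof.
move=> h1 h2 h0 phi hphi.
have [|Phi hPhi] := @choose_adj j (fun a psi => eqon i a (l - 1) k (parts phi j a) (bdry psi)).
  by move=> a ea; apply: h1 => //; apply: cocycle_parts.
have [|psi hpsi] := h2 (fun w => mesh j Phi w - after (inr j) phi w).
  move=> w; rewrite subrK => hw; rewrite bdryB bdry_mesh -(cocycle_after_loop hphi hw).
  apply/eqP; rewrite subr_eq0; apply/eqP; apply: (eq_mesh _ hw) => a v ea.
  rewrite (_ : l - 2 + 1 = l - 1); last by ring.
  by move/(hPhi _ ea).
exists (glue Phi psi); apply: bdry_glue => // w /hpsi <-.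
by rewrite opprB addrC subrK.
Qed.

Definition meshSurj i l := forall j psi, cocycle i j l 0 psi ->
  exists Phi, (forall a, e a j -> cocycle i a (l + 1) 0 (Phi a)) /\
    eqon i j l 0 psi (mesh j Phi).

(** In degree 1 the term H^0 on level l-2 need not vanish; surjectivity of the mesh map onto it
    suffices, because the primitives [Phi] may be corrected by cocycles. *)
Lemma exact_step1 i j l :
  (forall a, e a j -> exactAt i a (l - 1) 1) -> meshSurj i (l - 2) -> exactAt i j l 1.
Proof.
move=> h1 h2 phi hphi.
have [|Phi hPhi] := @choose_adj j (fun a psi => eqon i a (l - 1) 1 (parts phi j a) (bdry psi)).
  by move=> a ea; apply: h1 => //; apply: cocycle_parts.
have [|Psi [cPsi hPsi]] := h2 j (fun w => mesh j Phi w - after (inr j) phi w).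
  move=> w; rewrite add0r => hw; rewrite bdryB bdry_mesh -(cocycle_after_loop hphi hw).
  apply/eqP; rewrite subr_eq0; apply/eqP; apply: (eq_mesh _ hw) => a v ea.
  rewrite (_ : l - 2 + 1 = l - 1); last by ring.
  by move/(hPhi _ ea).
exists (glue (fun a v => Phi a v - Psi a v) (fun=> 0)); apply: bdry_glue.
- by rewrite word_nil andbF andbC.
- move=> a ea w hw; rewrite bdryB -(hPhi _ ea _ hw) (cPsi a ea) ?subr0 //.
  by rewrite (_ : l - 2 + 1 = l - 1) //; ring.
- move=> w hw; rewrite bdry_zero subr0 meshB -hPsi //.
  by rewrite opprB addrC subrK.
Qed.

(** * Slices are bricks *)

(* Elements of a slice are cocycles of degree 0, taken modulo equality on the relevant words. *)
Definition endo i l (f : 'I_n -> (seq (letter n) -> K) -> seq (letter n) -> K) :=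
  (forall j phi, cocycle i j l 0 phi -> cocycle i j l 0 (f j phi)) /\
  (forall j p1 p2 p3 c, cocycle i j l 0 p1 -> cocycle i j l 0 p2 ->
     eqon i j l 0 p3 (fun w => p1 w + c * p2 w) ->
     eqon i j l 0 (f j p3) (fun w => f j p1 w + c * f j p2 w)).

(** The slice at l is the representation with maps [parts] from level l+1 at j to level l at the
    neighbours; [f] and [f'] are the two halves of an endomorphism, and one common scalar must give
    both. *)
Definition brick i l := forall f f', endo i l f -> endo i (l + 1) f' ->
  (forall j a phi, e a j -> cocycle i j (l + 1) 0 phi ->
     eqon i a l 0 (parts (f' j phi) j a) (f a (parts phi j a))) ->
  exists c,
    (forall j phi, cocycle i j l 0 phi -> eqon i j l 0 (f j phi) (fun w => c * phi w)) /\
    (forall j phi, cocycle i j (l + 1) 0 phi ->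
       eqon i j (l + 1) 0 (f' j phi) (fun w => c * phi w)).

Lemma endo_scale i l f j phi psi c : endo i l f -> cocycle i j l 0 phi ->
  eqon i j l 0 psi (fun w => c * phi w) ->
  eqon i j l 0 (f j psi) (fun w => c * f j phi w).
Proof.
move=> [_ flin] hphi E.
have z : eqon i j l 0 (f j (fun=> 0)) (fun=> 0).
  move=> w hw; have c0 := @cocycle_zero i j l 0.
  have E1 : f j (fun=> 0) w = f j (fun=> 0) w + 1 * f j (fun=> 0) w.
    by apply: (flin j _ _ _ 1 c0 c0 _ w hw) => v _; rewrite mulr0 addr0.
  move/eqP: E1; rewrite mul1r -subr_eq0 opprD addrA subrr add0r oppr_eq0.
  by move/eqP.
move=> w hw; rewrite (flin j (fun=> 0) phi psi c) //; first by rewrite z // add0r.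
  exact: cocycle_zero.
by move=> v hv; rewrite E // add0r.
Qed.

Lemma sgn_sq (b : bool) : sgn K b * sgn K b = 1.
Proof. by rewrite /sgn -expr2 sqrr_sign. Qed.

(** Restriction along a single arrow is the mesh of a family supported at j, so parts always lie in
    the image of the mesh map. The sign is its own inverse. *)
Lemma parts_mesh j a phi : e a j ->
  parts phi j a =1 mesh a (fun b w => if b == j then sgn K (eps a j) * phi w else 0).
Proof.
move=> ea w; rewrite /mesh (bigD1 j) //= eqxx mulrA sgn_sq mul1r big1 ?addr0 //.
by move=> b /andP[_ /negPf ->]; rewrite mulr0.
Qed.

(* A cokernel of the mesh map at j splits off as a direct summand S_j; projecting onto it is a non-scalar endomorphism. *)
Lemma meshSurj_of_brick i l : brick i l ->
  (exists j phi, cocycle i j (l + 1) 0 phi /\ ~ eqon i j (l + 1) 0 phi (fun=> 0)) ->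
  meshSurj i l.
Proof.
move=> hb [j1 [phi1 [hphi1 nphi1]]] j0 psi0 hpsi0; apply: NNPP => nPhi.
pose P psi := exists2 Phi, (forall a, e a j0 -> cocycle i a (l + 1) 0 (Phi a))
                 & eqon i j0 l 0 psi (mesh j0 Phi).
have [|||u hu upsi0] := @separating_functional _ _ (words i j0 l 0) P psi0 (words_uniq _ _ _ _).
- exists (fun _ _ => 0) => [a _|w _]; first exact: cocycle_zero.
  by rewrite /mesh big1 // => a _; rewrite mulr0.
- move=> p q c [Phi hPhi hp] [Psi hPsi hq].
  exists (fun a w => Phi a w + c * Psi a w) => [a ea|w hw].
    by apply: cocycle_lin; [apply: hPhi | apply: hPsi].
  by rewrite mesh_lin hp ?hq.
- case=> p [Phi hPhi hp] E; apply: nPhi; exists Phi; split => // w hw.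
  by rewrite -hp // -E // mem_words.
(* [lam] kills the image of the mesh map at [j0], hence all parts, but not [psi0]. The rank-one map
   [lam phi * psi0] at [j0], zero elsewhere and on level l+1, is therefore an endomorphism of the
   slice. *)
pose lam phi : K := \sum_(v <- words i j0 l 0) u v * phi v.
have [|||c [hc hc']] := hb (fun j phi => if j == j0 then fun w => lam phi * psi0 w else fun=> 0)
   (fun _ _ _ => 0).
- split=> [j phi _|j p1 p2 p3 c _ _ E w _].
    by case: eqP => [->|_]; [apply: cocycleZ | apply: cocycle_zero].
  have [ej|_] := eqVneq j j0; last by rewrite mulr0 addr0.
  rewrite mulrA -mulrDl; congr (_ * _); rewrite /lam mulr_sumr -big_split !big_seq.
  by apply: eq_bigr => v; rewrite mem_words -ej => /E ->; rewrite mulrDr mulrCA.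
- split=> [j phi _|*]; first exact: cocycle_zero.
  by move=> w _; rewrite mulr0 addr0.
- move=> j a phi ea hphi w hw; rewrite /parts /after; case: eqP => // ea0; subst a.
  rewrite -/(parts phi j j0) (_ : lam _ = 0) ?mul0r //; apply: hu.
  exists (fun b w => if b == j then sgn K (eps j0 j) * phi w else 0) => [b eb|v _].
    by case: eqP => [->|_]; [apply: cocycleZ | apply: cocycle_zero].
  exact: parts_mesh.
have c0 : c = 0.
  apply/eqP; apply: contraT => cn0; case: nphi1 => w hw.
  by apply: (mulfI cn0); rewrite mulr0 -(hc' _ _ hphi1 w hw).
have [w hw pw] : exists2 w, word i j0 l 0 w & psi0 w != 0.
  apply: NNPP => h; move/eqP: upsi0; apply; rewrite big_seq big1 // => v.
  rewrite mem_words => hv; have [->|nz] := eqVneq (psi0 v) 0; first by rewrite mulr0.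
  by case: h; exists v.
have := hc _ _ hpsi0 w hw; rewrite eqxx c0 mul0r => /eqP.
by rewrite mulf_eq0 (negPf pw) orbF (negPf upsi0).
Qed.

(** When level l+1 is zero, compatibility is automatic, so every vertexwise linear endomorphism of
    level l is a scalar. For the rank-one map [phi w0 * psi0] at [j0] this leaves only the line
    spanned by [psi0]. *)
Lemma simple_of_brick i l : brick i l ->
  (forall j, exactAt i j (l + 1) 0) ->
  forall j0 psi0, cocycle i j0 l 0 psi0 -> ~ eqon i j0 l 0 psi0 (fun=> 0) ->
  (forall j, j != j0 -> exactAt i j l 0) /\
  forall phi, cocycle i j0 l 0 phi -> exists c, eqon i j0 l 0 phi (fun w => c * psi0 w).
Proof.
move=> hb hz j0 psi0 hpsi0 npsi0.
have z j phi w : cocycle i j (l + 1) 0 phi -> word i j (l + 1) 0 w -> phi w = 0.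
  by move=> /hz[psi E] hw; rewrite E // (bdry0 _ hw).
have [w0 hw0 pw0] : exists2 w, word i j0 l 0 w & psi0 w != 0.
  apply: NNPP => h; apply: npsi0 => v hv.
  by apply/eqP; apply: contraT => nz; case: h; exists v.
have [|||c [hc _]] := hb (fun j phi => if j == j0 then fun w => phi w0 * psi0 w else fun=> 0)
   (fun _ _ _ => 0).
- split=> [j phi _|j p1 p2 p3 c _ _ E w _].
    by case: eqP => [->|_]; [apply: cocycleZ | apply: cocycle_zero].
  have [ej|_] := eqVneq j j0; last by rewrite mulr0 addr0.
  by rewrite E ?ej // mulrA -mulrDl.
- split=> [j phi _|*]; first exact: cocycle_zero.
  by move=> w _; rewrite mulr0 addr0.
- move=> j a phi ea hphi w hw; rewrite /parts /after; case: eqP => // ea0; subst a.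
  by rewrite (z _ _ _ hphi) ?mul0r // word_arrow eqxx ea addrK.
have cE : c = psi0 w0.
  by apply: (mulIf pw0); rewrite -(hc _ _ hpsi0) // eqxx.
have c0 : c != 0 by rewrite cE.
split=> [j nj phi hphi|phi hphi].
  exists (fun=> 0) => w hw; rewrite bdry_zero; apply: (mulfI c0).
  by rewrite -(hc _ _ hphi) // (negPf nj) mulr0.
exists (phi w0 / c) => w hw; apply: (mulfI c0).
by rewrite -(hc _ _ hphi) // eqxx mulrA mulrCA mulfV // mulr1.
Qed.

Lemma word_level0 i j k w : word i j 0 k w -> [/\ w = [::], i = j & k = 0].
Proof.
case: w => [|[[a b]|b] w].
- by rewrite word_nil => /and3P[/eqP -> _ /eqP ->].
- by rewrite word_arrow => /and3P[_ _ /word_ge0[]].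
- by rewrite word_loop => /andP[_ /word_ge0[]].
Qed.

Lemma arrow_level i j l w : word i j (l + 1) 0 w -> 0 <= l ->
  exists a v, [/\ w = inl (a, j) :: v, e a j & word i a l 0 v].
Proof.
case: w => [|[[a b]|b] w] + hl.
- by rewrite word_nil => /and3P[_ /eqP h _]; lia.
- by rewrite word_arrow addrK => /and3P[/eqP -> ea hw]; exists a, w.
- by rewrite word_loop => /andP[_ /word_ge0[]].
Qed.

(** Level 0 is the line at i, where linear maps are scalars; a level 1 cochain is determined by its
    parts, so the same scalar acts there. *)
Lemma brick0 i : brick i 0.
Proof.
move=> f f' hf hf' hc; pose c := f i (fun=> 1) [::]; exists c.
have h0 j phi : eqon i j 0 0 (f j phi) (fun w => c * phi w).
  move=> w /[dup] hw /word_level0[ew ej _]; subst w j.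
  rewrite (endo_scale (phi := fun=> 1) (c := phi [::]) hf _ _ hw) 1?mulrC //.
    by move=> v /word_level0[].
  by move=> v /word_level0[-> _ _]; rewrite mul1r.
split=> [j phi _|j phi hphi w]; first exact: h0.
case/arrow_level => // a [v [-> ea hv]].
by have := hc j a phi ea hphi v hv; rewrite /parts /after => ->; rewrite h0.
Qed.

(* An endomorphism of the reflected slice preserves the kernel of the mesh map, so it descends to the image, which is all of level l. *)
Lemma brick_step i l : 0 <= l -> brick i l -> meshSurj i l -> brick i (l + 1).
Proof.
move=> hl hb hs f f' hf hf' hc; have [fco flin] := hf.
pose good j psi Phi := (forall a, e a j -> cocycle i a (l + 1) 0 (Phi a)) /\
    eqon i j l 0 psi (mesh j Phi).
pose lift j psi := epsilon (inhabits (fun _ _ => 0)) (good j psi).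
have liftP j psi : cocycle i j l 0 psi -> good j psi (lift j psi).
  by move=> h; apply: epsilon_spec; apply: hs.
(* [g] is the map that [f] induces on level l through chosen mesh preimages; [ker] and [gE] give
   independence of the choice. *)
pose g j psi := mesh j (fun a => f a (lift j psi a)).
(* A family with zero mesh glues to a cocycle on level l+2. Its image under [f'] is again a cocycle,
   with parts [f a (Phi a)] by compatibility. *)
have ker j Phi : good j (fun=> 0) Phi -> eqon i j l 0 (mesh j (fun a => f a (Phi a))) (fun=> 0).
  case=> cPhi mPhi.
  have hG : cocycle i j (l + 1 + 1) 0 (glue Phi (fun=> 0)).
    apply: cocycle_glue => [a ea|w]; first by rewrite addrK; apply: cPhi.
    rewrite (_ : l + 1 + 1 - 2 = l); last by ring.
    by move=> /mPhi <-; rewrite bdry_zero.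
  have [/(_ j _ hG) hG' _] := hf'; have hm := cocycle_after_loop hG'.
  move=> w hw; have := hm w; rewrite (_ : l + 1 + 1 - 2 = l); last by ring.
  rewrite (bdry0 _ hw) => <- //; apply: (eq_mesh _ hw) => a v ea hv.
  by rewrite (hc j a _ ea hG v hv).
have gE j psi Phi : cocycle i j l 0 psi -> good j psi Phi ->
    eqon i j l 0 (g j psi) (mesh j (fun a => f a (Phi a))).
  move=> hpsi [cPhi mPhi]; have [cL mL] := liftP _ _ hpsi.
  pose Psi a w := lift j psi a w + (-1) * Phi a w.
  have /ker k0 : good j (fun=> 0) Psi.
    split=> [a ea|w hw]; first by apply: cocycle_lin; [apply: cL | apply: cPhi].
    by rewrite mesh_lin -mL // -mPhi // mulN1r subrr.
  move=> w hw; apply/eqP; rewrite -subr_eq0 -mulN1r -mesh_lin -(k0 w hw).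
  apply/eqP; apply: (eq_mesh _ hw) => a v ea hv; apply/esym.
  by apply: flin => //; [apply: cL | apply: cPhi].
have hg : endo i l g.
  split=> [j psi hpsi|j p1 p2 p3 c h1 h2 E w hw].
    apply: cocycle_mesh => a ea; apply: fco.
    by case: (liftP _ _ hpsi) => h _; apply: h.
  have [c1 m1] := liftP _ _ h1; have [c2 m2] := liftP _ _ h2.
  pose Phi a w := lift j p1 a w + c * lift j p2 a w.
  rewrite (@gE j p3 Phi) //.
  - rewrite -mesh_lin; apply: (eq_mesh _ hw) => a v ea hv.
    by apply: flin => //; [apply: c1 | apply: c2].
  - apply: (eqon_cocycle (phi := fun w => p1 w + c * p2 w)); last exact: cocycle_lin.
    by move=> v hv; rewrite E.
  - split=> [a ea|v hv]; first by apply: cocycle_lin; [apply: c1 | apply: c2].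
    by rewrite E // mesh_lin m1 // m2.
have hcg j a phi : e a j -> cocycle i j (l + 1) 0 phi ->
    eqon i a l 0 (parts (f j phi) j a) (g a (parts phi j a)).
  move=> ea hphi w hw.
  (* The preimage of [parts phi j a] given by [parts_mesh], supported at j, replaces the chosen
     one. *)
  pose Phi b w := if b == j then sgn K (eps a j) * phi w else 0.
  have cp : cocycle i a l 0 (parts phi j a).
    by have := cocycle_parts hphi ea; rewrite addrK.
  rewrite (@gE a _ Phi) // ?(parts_mesh _ ea).
    apply: (eq_mesh _ hw) => b v eb hv; apply/esym.
    rewrite /Phi; case: (eqVneq b j) hv => [->|_] hv.
      by apply: (endo_scale hf hphi).
    rewrite (endo_scale (phi := fun=> 0) (c := 0) hf _ _ hv) ?mul0r //.
    exact: cocycle_zero.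
  split=> [b eb|u _]; last exact: parts_mesh.
  by rewrite /Phi; case: eqP => [->|_]; [apply: cocycleZ | apply: cocycle_zero].
have [c [_ hfc]] := hb g f hg hf hcg.
exists c; split=> // j phi hphi w /arrow_level[|a [v [-> ea hv]]]; first by lia.
have := hc j a phi ea hphi v hv; rewrite /parts /after => ->.
by rewrite hfc //; have := cocycle_parts hphi ea; rewrite addrK.
Qed.

(** * Vanishing in positive degrees *)

Lemma exact_vacuous i j l k : (forall w, ~~ word i j l k w) -> exactAt i j l k.
Proof. by move=> h phi _; exists (fun=> 0) => w; rewrite (negPf (h w)). Qed.

Lemma exact_neg i j l k : (l < 0) || (k < 0) -> exactAt i j l k.
Proof.
move=> h; apply: exact_vacuous => w; apply: contraL h => /word_ge0[hl hk].
by rewrite negb_or -!leNgt hl hk.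
Qed.

(** Degree 1 uses mesh surjectivity two levels down, which explains the bound [L.+1]; higher degrees
    use exactness there. *)
Lemma exact_pos i (L : nat) : (forall l : nat, (l < L)%N -> meshSurj i l) ->
  forall (l : nat) j k, (l <= L.+1)%N -> 0 < k -> exactAt i j l k.
Proof.
move=> hs l; elim/ltn_ind: l => l IHl j k hl hk.
case: l => [|l] in IHl hl *.
  by apply: exact_vacuous => w; apply: contraL hk => /word_level0[_ _ ->].
have h1 a : exactAt i a (l.+1%:Z - 1) k.
  by rewrite predS; apply: IHl => //; apply: ltnW.
have [->|k1] := eqVneq k 1.
  apply: exact_step1 => [a _|]; first by rewrite predS; apply: IHl => //; lia.
  case: l => [|l] in IHl hl h1 *.
    move=> a psi _; exists (fun _ _ => 0); split=> [b _|w /word_ge0[] //].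
    exact: cocycle_zero.
  by rewrite pred2S; apply: hs.
apply: exact_step => //; last by rewrite word_nil andbA andbC; lia.
case: l => [|l] in IHl hl h1 *; first exact: exact_neg.
by rewrite pred2S; apply: IHl; lia.
Qed.

(** A nonzero next level makes the mesh map onto, and surjectivity carries the brick property one
    level up. *)
Lemma brick_run i (L : nat) :
  (forall l : nat, (l <= L)%N -> exists j, ~ exactAt i j l 0) ->
  brick i L /\ forall l : nat, (l < L)%N -> meshSurj i l.
Proof.
elim: L => [_|L IHL hL]; first by split=> //; apply: brick0.
have [|hb hs] := IHL; first by move=> l hl; apply: hL; apply: leqW.
have hsL : meshSurj i L.
  apply: meshSurj_of_brick => //; have [j hj] := hL _ (leqnn _).
  exists j; apply: NNPP => h; apply: hj => phi.
  rewrite -addn1 PoszD => hphi; apply: NNPP => hn; apply: h; exists phi; split=> // E.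
  by apply: hn; exists (fun=> 0) => w hw; rewrite bdry_zero E.
split; first by rewrite -addn1 PoszD; apply: brick_step.
by move=> l; rewrite ltnS leq_eqVlt => /predU1P[-> //|/hs].
Qed.

(** * Euler characteristics and Chebyshev matrices *)

Definition evec (B : seq (seq (letter n))) phi : 'cV[K]_(size B) :=
  \col_r phi (nth [::] B r).

Definition dmx (B B' : seq (seq (letter n))) : 'M[K]_(size B, size B') :=
  \matrix_(r, c) dcoef K e eps (nth [::] B r) (nth [::] B' c).

Lemma evec_surj B (x : 'cV[K]_(size B)) : uniq B -> exists phi, evec B phi = x.
Proof.
move=> uB; exists (fun w => if insub (index w B) is Some r then x r 0 else 0).
apply/colP => r; rewrite mxE index_uniq // (insubT (fun m => m < size B)%N (ltn_ord r)) /=.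
by congr (x _ _); apply: val_inj.
Qed.

Lemma evec_eq B phi psi : evec B phi = evec B psi <-> {in B, phi =1 psi}.
Proof.
split=> [E w wB|E]; last first.
  by apply/colP => r; rewrite !mxE E // mem_nth.
have hi : (index w B < size B)%N by rewrite index_mem.
by move/colP/(_ (Ordinal hi)): E; rewrite !mxE /= nth_index.
Qed.

Lemma evec_words i j l k phi psi :
  evec (words i j l k) phi = evec (words i j l k) psi <-> eqon i j l k phi psi.
Proof. by rewrite evec_eq; split=> h w; move: (h w); rewrite mem_words. Qed.

Lemma dmx_evec B B' phi : uniq B' ->
  (forall w q, w \in B -> q \in dterm K e eps w -> q.2 \in B') ->
  dmx B B' *m evec B' phi = evec B (bdry phi).
Proof.
move=> uB' h; apply/colP => r; rewrite !mxE /bdry.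
transitivity (\sum_(v <- B') dcoef K e eps (nth [::] B r) v * phi v).
  by rewrite (big_nth [::]) big_mkord; apply: eq_bigr => c _; rewrite !mxE.
rewrite /dcoef; under eq_bigr do rewrite mulr_suml.
rewrite exchange_big /= !big_seq; apply: eq_bigr => q hq.
have qB : q.2 \in B' by apply: h hq; rewrite mem_nth.
rewrite (bigD1_seq q.2) //= eqxx big1 ?addr0 // => v nv.
by rewrite eq_sym (negPf nv) mul0r.
Qed.

Notation wmx i j l k := (dmx (words i j l (k + 1)) (words i j l k)).

Lemma wmx_evec i j l k phi :
  wmx i j l k *m evec (words i j l k) phi = evec (words i j l (k + 1)) (bdry phi).
Proof.
apply: dmx_evec => [|w q]; first exact: words_uniq.
by rewrite !mem_words => hw hq; have := mem_dterm hq hw; rewrite addrK.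
Qed.

Lemma evec0 B : evec B (fun=> 0) = 0.
Proof. by apply/colP => r; rewrite !mxE. Qed.

Lemma wmx_cocycle i j l k phi :
  wmx i j l k *m evec (words i j l k) phi = 0 <-> cocycle i j l k phi.
Proof. by rewrite wmx_evec -(evec0 (words i j l (k + 1))) evec_words. Qed.

Lemma wmx_mul0 i j l k : wmx i j l (k + 1) *m wmx i j l k = 0.
Proof.
apply/matrixP => r c.
suff /colP/(_ r) : col c (wmx i j l (k + 1) *m wmx i j l k) = 0 by rewrite !mxE.
have [phi Ephi] := evec_surj (delta_mx c 0) (words_uniq i j l k).
rewrite colE -Ephi -mulmxA !wmx_evec -(evec0 (words i j l (k + 1 + 1))).
by apply/evec_words => w _; rewrite bdry_bdry.
Qed.

Definition wrank i j l k : nat := \rank (wmx i j l k).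

Lemma exact_rank i j l k : exactAt i j l (k + 1) ->
  (wrank i j l (k + 1) + wrank i j l k = size (words i j l (k + 1)))%N.
Proof.
move=> hE; rewrite /wrank; rewrite -[\rank (wmx i j l (k + 1))]mxrank_tr -[\rank (wmx i j l k)]mxrank_tr.
have : (kermx (wmx i j l (k + 1))^T :=: (wmx i j l k)^T)%MS.
  apply/eqmxP/andP; split; last by rewrite sub_kermx -trmx_mul wmx_mul0 trmx0.
  apply/row_subP => r.
  have [phi Ephi] := evec_surj (row r (kermx (wmx i j l (k + 1))^T))^T (words_uniq _ _ _ _).
  have [psi hpsi] : exists psi, eqon i j l (k + 1) phi (bdry psi).
    by apply: hE; apply/wmx_cocycle; rewrite Ephi mul_row_kermx_tr.
  apply/submxP; exists (evec (words i j l k) psi)^T; rewrite -trmx_mul wmx_evec.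
  by apply: (canRL (@trmxK _ _ _)); rewrite -Ephi; apply/evec_words.
move=> E; rewrite -E mxrank_ker addnC subnK //; exact: rank_leq_row.
Qed.

Definition dim0 i j l : nat := \rank (kermx (wmx i j l 0)^T).

Lemma dim0E i j l : dim0 i j l = (size (words i j l 0) - wrank i j l 0)%N.
Proof. by rewrite /wrank /dim0 mxrank_ker mxrank_tr. Qed.

Lemma dim0_eq0 i j l : dim0 i j l = 0%N <-> exactAt i j l 0.
Proof.
rewrite /dim0; split=> [/eqP|hE].
  rewrite mxrank_eq0 => /eqP kE phi hphi; exists (fun=> 0).
  apply/evec_words; apply: trmx_inj.
  have : ((evec (words i j l 0) phi)^T <= kermx (wmx i j l 0)^T)%MS.
    by rewrite sub_kermx -trmx_mul; move/wmx_cocycle: hphi => ->; rewrite trmx0.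
  rewrite kE submx0 => /eqP ->; rewrite -(trmx0 _ _ _); congr _^T; apply/esym.
  by rewrite -[RHS]evec0; apply/evec_words => w _; rewrite bdry_zero.
apply/eqP; rewrite mxrank_eq0; apply/eqP/row_matrixP => r; rewrite row0.
have [phi Ephi] := evec_surj (row r (kermx (wmx i j l 0)^T))^T (words_uniq _ _ _ _).
have [psi hpsi] : exists psi, eqon i j l 0 phi (bdry psi).
  by apply: hE; apply/wmx_cocycle; rewrite Ephi mul_row_kermx_tr.
apply: trmx_inj; rewrite -Ephi trmx0 -[RHS]evec0; apply/evec_words => w hw.
by rewrite hpsi // (bdry0 _ hw).
Qed.

Lemma dim0_eq1 i j l psi0 : ~ exactAt i j l 0 ->
  (forall phi, cocycle i j l 0 phi -> exists c, eqon i j l 0 phi (fun w => c * psi0 w)) ->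
  dim0 i j l = 1%N.
Proof.
move=> hE h; apply/eqP; rewrite eqn_leq lt0n; apply/andP; split; last first.
  by apply/eqP => /dim0_eq0.
apply: leq_trans (rank_leq_row (evec (words i j l 0) psi0)^T).
apply: mxrankS; apply/row_subP => r.
have [phi Ephi] := evec_surj (row r (kermx (wmx i j l 0)^T))^T (words_uniq _ _ _ _).
have [c hc] : exists c, eqon i j l 0 phi (fun w => c * psi0 w).
  by apply: h; apply/wmx_cocycle; rewrite Ephi mul_row_kermx_tr.
apply/sub_rVP; exists c; apply: trmx_inj; rewrite -Ephi linearZ /= trmxK.
rewrite (proj2 (evec_words _ _ _ _ _ _) hc); apply/colP => s.
by rewrite !mxE.
Qed.

Lemma word_le i j l k w : word i j l k w -> k <= l.
Proof.
case/and4P=> _ _ /eqP <- /eqP <-; rewrite lez_nat.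
by elim: w => //= x w IHw; rewrite /wtotal /= -/(wtotal w); case: x => * /=; lia.
Qed.

Lemma words_nil i j l k : l < k -> words i j l k = [::].
Proof.
move=> hk; case E: (words i j l k) => [//|w s].
have : w \in words i j l k by rewrite E inE eqxx.
by rewrite mem_words => /word_le; lia.
Qed.

Lemma words_neg i j l k : k < 0 -> words i j l k = [::].
Proof. by move=> hk; rewrite /words [0 <= k]leNgt hk andbF. Qed.

Lemma size_words_rec i j l k : size (words i j l k) =
  (\sum_(a | e a j) size (words i a (l - 1) k)
   + size (words i j (l - 2) (k - 1)) + word i j l k [::])%N.
Proof.
pose s1 := [seq inl (a, j) :: w | a <- [seq a <- enum 'I_n | e a j], w <- words i a (l - 1) k].
pose s2 := [seq inr j :: w | w <- words i j (l - 2) (k - 1)].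
pose s3 : seq (seq (letter n)) := nseq (word i j l k [::]) [::].
have us1 : uniq s1.
  apply: allpairs_uniq_dep; first by rewrite filter_uniq ?enum_uniq.
    by move=> a _; apply: words_uniq.
  by move=> [a w] [b v] /= _ _ [] -> ->.
have /perm_size -> : perm_eq (words i j l k) (s1 ++ s2 ++ s3).
  apply: uniq_perm; first exact: words_uniq.
    have us3 : uniq s3 by rewrite /s3; case: (word i j l k [::]).
    have us2 : uniq s2 by rewrite map_inj_uniq ?words_uniq // => w v [].
    rewrite !cat_uniq us1 us2 us3 andbT !andTb; apply/andP; split; last first.
      by apply/hasPn => w; rewrite mem_nseq => /andP[_ /eqP ->]; apply/mapP => -[].
    apply/hasPn => w; rewrite mem_cat => /orP[/mapP[v _ ->]|].
      by apply/negP => /allpairsPdep[a [u []]].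
    by rewrite mem_nseq => /andP[_ /eqP ->]; apply/negP => /allpairsPdep[a [u []]].
  move=> w; rewrite mem_words !mem_cat; case: w => [|[[a b]|b] w].
  - have -> : ([::] \in s1) = false by apply/negP => /allpairsPdep[a [u []]].
    have -> : ([::] \in s2) = false by apply/negP => /mapP[].
    by rewrite mem_nseq eqxx andbT lt0b.
  - have -> : (inl (a, b) :: w \in s2) = false by apply/negP => /mapP[].
    rewrite word_arrow mem_nseq andbF !orbF.
    apply/and3P/allpairsPdep => [[/eqP -> ea hw]|[a' [v []]]].
      by exists a, w; rewrite mem_filter ea mem_enum mem_words.
    by rewrite mem_filter mem_words => /andP[ea _] hv [-> -> ->].
  - have -> : (inr b :: w \in s1) = false by apply/negP => /allpairsPdep[a [u []]].
    rewrite word_loop mem_nseq andbF orbF orFb.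
    apply/andP/mapP => [[/eqP -> hw]|[v]]; first by exists w; rewrite ?mem_words.
    by rewrite mem_words => hv [-> ->].
rewrite !size_cat size_map size_nseq addnA size_allpairs_dep; congr (_ + _ + _)%N.
by rewrite sumnE big_map big_filter big_enum_cond; apply: eq_bigl => a; rewrite inE.
Qed.

(** Any [M > l] gives the full Euler characteristic. The bound is kept free because the loop term of
    the recursion loses one degree. *)
Definition euler (M : nat) i j l : int := \sum_(k < M) (-1) ^+ k * (size (words i j l k))%:Z.

Lemma euler_stable M (l : nat) i j : (l < M)%N -> euler M i j l = euler l.+1 i j l.
Proof.
elim: M => // M IHM; rewrite ltnS leq_eqVlt => /predU1P[-> //|hl].
rewrite /euler big_ord_recr /= words_nil ?mulr0 ?addr0; last by rewrite ltz_nat.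
exact: IHM.
Qed.

Lemma euler_rec M i j l : euler M.+1 i j l =
  \sum_(a | e a j) euler M.+1 i a (l - 1) - euler M i j (l - 2) + (word i j l 0 [::])%:Z.
Proof.
rewrite /euler; under eq_bigr do rewrite size_words_rec !PoszD !mulrDr.
rewrite !big_split /=; congr (_ + _ + _).
- rewrite exchange_big; apply: eq_bigr => k _ /=.
  by rewrite -mulr_sumr; congr (_ * _); rewrite (big_morph Posz PoszD (erefl _)).
- rewrite big_ord_recl /= words_neg // mulr0 add0r -sumrN.
  apply: eq_bigr => k _; rewrite exprS mulN1r mulNr; congr (- (_ * _)).
  by rewrite /bump add1n predS.
- rewrite big_ord_recl /= mul1r big1 ?addr0 // => k _.
  by rewrite word_nil andbA andbF mulr0.
Qed.

Lemma euler_dim0 i j (l : nat) : (forall k, 0 < k -> exactAt i j l k) ->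
  euler l.+1 i j l = dim0 i j l.
Proof.
move=> hE.
have rk k : (wrank i j l k <= size (words i j l k))%N by apply: rank_leq_col.
(* In an exact degree the number of words is the sum of the two adjacent ranks, so the alternating
   sum telescopes. *)
have tele (M : nat) : euler M.+1 i j l
    = (dim0 i j l)%:Z + (-1) ^+ M * (wrank i j l M)%:Z.
  elim: M => [|M IHM].
    rewrite /euler big_ord1 !mul1r dim0E -PoszD subnK //; exact: (rk 0).
  rewrite /euler big_ord_recr /= -/(euler _ _ _ _) IHM exprS mulN1r !mulNr.
  have -> : (size (words i j l M.+1))%:Z = (wrank i j l M.+1)%:Z + (wrank i j l M)%:Z.
    have := @exact_rank i j l M; rewrite (_ : M%:Z + 1 = M.+1%:Z); last by lia.
    by move=> <-; [rewrite PoszD | apply: hE; lia].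
  by ring.
rewrite -(@euler_stable l.+2) // tele.
by have := rk l.+1; rewrite words_nil ?ltz_nat // leqn0 => /eqP ->; rewrite mulr0 addr0.
Qed.

Definition adjm : 'M[int]_n := \matrix_(a, b) (e a b)%:Z.

(** Chebyshev polynomials of the second kind, normalised by U_0 = 1 and U_1 = x, at the adjacency
    matrix C. *)
Fixpoint chebU (m : nat) : 'M[int]_n :=
  match m with
  | 0 => 1
  | p.+1 => match p with 0 => adjm | q.+1 => adjm * chebU p - chebU q end
  end.

Lemma chebUSS m : chebU m.+2 = adjm * chebU m.+1 - chebU m.
Proof. by []. Qed.

Lemma adjm_tr : adjm^T = adjm.
Proof. by apply/matrixP => a b; rewrite !mxE e_sym. Qed.

Lemma chebU_comm m p : adjm ^+ p * chebU m = chebU m * adjm ^+ p.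
Proof.
apply/esym/commrX; elim/two_step: m => [||m h0 h1]; [exact/commr_sym/commr1 | by [] |].
rewrite chebUSS; apply/commr_sym/commrB; last exact/commr_sym.
by apply: commrM; last exact/commr_sym.
Qed.

Lemma chebU_tr m : (chebU m)^T = chebU m.
Proof.
elim/two_step: m => [||m h0 h1]; [exact: trmx1 | exact: adjm_tr |].
rewrite chebUSS raddfB /= h0; congr (_ - _); apply: etrans (trmx_mul _ _) _.
by rewrite h1 adjm_tr; have := chebU_comm m.+1 1; rewrite expr1.
Qed.

Lemma chebU_sym m a b : chebU m a b = chebU m b a.
Proof. by rewrite -{1}chebU_tr mxE. Qed.

(** A pure count of words: both sides obey the same two-step recursion. *)
Lemma chebU_euler m i j : chebU m j i = euler m.+1 i j m.
Proof.
have E0 a : euler 1 i a 0 = (i == a)%:Z.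
  rewrite euler_rec big1 => [|b _]; last by rewrite /euler big_ord1 /words /= mulr0.
  by rewrite /euler big_ord0 oppr0 !add0r word_nil !eqxx !andbT.
elim/two_step: m j => [j|j|m h0 h1 j].
- by rewrite E0 /= !mxE eq_sym; case: eqP.
- rewrite euler_rec word_nil /= andbF addr0 /= mxE.
  rewrite [X in _ - X]big1 ?subr0 => [|k _]; last by rewrite /words /= mulr0.
  under eq_bigr => a _ do rewrite predS euler_stable // E0.
  have [eij|eij] := boolP (e i j).
    rewrite (bigD1 i) //= eqxx big1 ?addr0; first by rewrite e_sym eij.
    by move=> a /andP[_]; rewrite eq_sym => /negPf ->.
  rewrite big1 => [|a ea]; first by rewrite e_sym (negPf eij).
  by case: eqP ea => // <- ea; rewrite ea in eij.
- rewrite chebUSS euler_rec word_nil /= andbF addr0 pred2S predS.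
  rewrite !mxE euler_stable // -h0; congr (_ - _).
  rewrite [RHS]big_mkcond /=; apply: eq_bigr => a _; rewrite !mxE e_sym h1.
  by case: (e a j); rewrite ?mul0r // mul1r euler_stable.
Qed.

(** Nonzero levels below m give exactness in positive degrees on level m, so only H^0 contributes to
    the Euler characteristic. *)
Lemma dim0_cheb i (m : nat) :
  (forall l : nat, (l < m)%N -> exists j, ~ exactAt i j l 0) ->
  forall j, (dim0 i j m)%:Z = chebU m j i.
Proof.
move=> h j; rewrite chebU_euler euler_dim0 // => k.
case: m h => [|m] h; first by apply: (@exact_pos i 0%N).
by have [_ hs] := brick_run h; apply: (exact_pos hs).
Qed.

(** * Periodicity *)

(* h + 2 is the Coxeter number. *)
Section Period.
Variables (h : nat) (o : 'I_n).
Hypothesis cheb_neq0 : forall m, (m < h.+1)%N -> exists j, chebU m j o != 0.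
Hypothesis cheb_eq0 : forall j, chebU h.+1 j o = 0.
Hypothesis connected : forall a b, exists p, (adjm ^+ p) a b != 0.

Lemma adjmX_ge0 p a b : 0 <= (adjm ^+ p) a b.
Proof.
elim: p a b => [|p IHp] a b; first by rewrite !mxE; case: eqP.
by rewrite exprS mxE; apply: sumr_ge0 => c _; rewrite mulr_ge0 // mxE.
Qed.

(** * Transfer of the vanishing level from column [o] to every column *)

Lemma base_nonzero m : (m < h.+1)%N -> exists j, ~ exactAt o j m 0.
Proof.
elim/ltn_ind: m => m IHm hm; have [j nz] := cheb_neq0 hm.
have D : forall j, (dim0 o j m)%:Z = chebU m j o.
  by apply: dim0_cheb => l hl; apply: IHm => //; apply: ltn_trans hl hm.
by exists j => /dim0_eq0 E; move: nz; rewrite -D E eqxx.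
Qed.

(** The entry (o, i) of C^p U_m(C) = U_m(C) C^p; by symmetry of U_m(C) it ties column i to column
    [o]. *)
Lemma swap_cheb m p i :
  \sum_j (adjm ^+ p) o j * chebU m j i = \sum_w chebU m w o * (adjm ^+ p) w i.
Proof.
have := congr1 (fun M : 'M_n => M o i) (chebU_comm m p); rewrite /= !mxE => ->.
by apply: eq_bigr => w _; rewrite chebU_sym.
Qed.

(** If level m vanished for i, the right side of [swap_cheb] would be a zero sum of nonnegative
    terms, yet a walk to i from a vertex in the support of column [o] contributes a positive one. *)
Lemma all_nonzero i m : (m < h.+1)%N -> exists j, ~ exactAt i j m 0.
Proof.
elim/ltn_ind: m => m IHm hm; apply: NNPP => hn.
have D : forall j, (dim0 i j m)%:Z = chebU m j i.
  by apply: dim0_cheb => l hl; apply: IHm => //; apply: ltn_trans hl hm.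
have Do : forall j, (dim0 o j m)%:Z = chebU m j o.
  by apply: dim0_cheb => l hl; apply: base_nonzero; apply: ltn_trans hl hm.
have Do_ge0 j : 0 <= chebU m j o by rewrite -Do.
have hz j : chebU m j i = 0.
  rewrite -D; apply/eqP; rewrite eqz_nat; apply/eqP/dim0_eq0; apply: NNPP => hj.
  by apply: hn; exists j.
have [w nw] := cheb_neq0 hm; have [p np] := connected w i.
have := swap_cheb m p i; have -> : \sum_j (adjm ^+ p) o j * chebU m j i = 0.
  by apply: big1 => j _; rewrite hz mulr0.
move/esym/psumr_eq0P => /(_ _ w isT) E.
have /eqP := E (fun c _ => mulr_ge0 (Do_ge0 c) (adjmX_ge0 p c i)).
by rewrite mulf_eq0 (negPf nw) (negPf np).
Qed.

Lemma dim0_low i (m : nat) j : (m <= h.+1)%N -> (dim0 i j m)%:Z = chebU m j i.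
Proof.
move=> hm; apply: dim0_cheb => l hl; apply: all_nonzero; exact: leq_trans hl hm.
Qed.

(** The same comparison in the other direction: the entries of column i are dimensions, hence
    nonnegative, and a walk from [o] to j forces the one at j to vanish. *)
Lemma all_top i j : exactAt i j h.+1 0.
Proof.
apply/dim0_eq0/eqP; rewrite -eqz_nat dim0_low //.
have [p np] := connected o j.
have U_ge0 c : 0 <= chebU h.+1 c i by rewrite -dim0_low.
have := swap_cheb h.+1 p i; have -> : \sum_w chebU h.+1 w o * (adjm ^+ p) w i = 0.
  by apply: big1 => w _; rewrite cheb_eq0 mul0r.
move/psumr_eq0P => /(_ _ j isT) E.
have /eqP := E (fun c _ => mulr_ge0 (adjmX_ge0 p o c) (U_ge0 c)).
by rewrite mulf_eq0 (negPf np).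
Qed.

Lemma exact_low i j (l : nat) k : (l <= h.+1)%N -> 0 < k -> exactAt i j l k.
Proof.
move=> hl k0; have [|_ hs] := @brick_run i h; first by move=> m; apply: all_nonzero.
exact: exact_pos hs _ _ _ hl k0.
Qed.

Lemma socle i : exists nu psi0,
  [/\ cocycle i nu h 0 psi0, ~ eqon i nu h 0 psi0 (fun=> 0),
      forall j, j != nu -> exactAt i j h 0 &
      forall phi, cocycle i nu h 0 phi -> exists c, eqon i nu h 0 phi (fun w => c * psi0 w)].
Proof.
have [nu hnu] := @all_nonzero i h (ltnSn h).
have [psi0 [c0 n0]] : exists psi0, cocycle i nu h 0 psi0 /\ ~ eqon i nu h 0 psi0 (fun=> 0).
  apply: NNPP => hn; apply: hnu => phi hphi; exists (fun=> 0) => w hw.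
  rewrite bdry_zero; apply: NNPP => nz; apply: hn; exists phi; split=> // E.
  by apply: nz; apply: E.
exists nu, psi0.
have [|hb _] := @brick_run i h; first by move=> m; apply: all_nonzero.
have [|h1 h2] := simple_of_brick hb _ c0 n0; last by split.
by move=> j; rewrite -[1]/(1%:Z) -PoszD addn1; apply: all_top.
Qed.

Definition isSocle i nu psi0 :=
  [/\ cocycle i nu h 0 psi0, ~ eqon i nu h 0 psi0 (fun=> 0),
      forall j, j != nu -> exactAt i j h 0 &
      forall phi, cocycle i nu h 0 phi -> exists c, eqon i nu h 0 phi (fun w => c * psi0 w)].

Lemma socle_dim i nu psi0 j : isSocle i nu psi0 -> chebU h j i = (j == nu)%:Z.
Proof.
move=> [c0 n0 hj h1]; rewrite -dim0_low //; congr Posz.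
have [->|nj] := eqVneq j nu; last by apply/dim0_eq0/hj.
apply: (dim0_eq1 _ h1) => /(_ _ c0)[psi E]; apply: n0 => w hw.
by rewrite E // (bdry0 _ hw).
Qed.

(** By [socle_dim], U_h(C) is the matrix of the map nu, and it is symmetric. *)
Lemma socle_invol i nu nu' psi psi' :
  isSocle i nu psi -> isSocle nu nu' psi' -> nu' = i.
Proof.
move=> /socle_dim D /socle_dim D'; have := D nu; rewrite chebU_sym D' eqxx.
by case: eqP.
Qed.

(* The transpose of right multiplication by the element of A given by the (coefficient, word) list s. *)
Definition act (s : seq (K * seq (letter n))) phi w : K := \sum_(q <- s) q.1 * phi (w ++ q.2).

Definition supported i nu (H : int) k (s : seq (K * seq (letter n))) :=
  forall q, q \in s -> word i nu H k q.2.

(** Vanishing on all coboundaries says that the element given by [s] is a cycle. *)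
Definition closed (s : seq (K * seq (letter n))) := forall phi, act s (bdry phi) [::] = 0.

Lemma actB s phi psi w : act s (fun v => phi v - psi v) w = act s phi w - act s psi w.
Proof. by rewrite /act -sumrB; apply: eq_bigr => q _; rewrite mulrBr. Qed.

Lemma act_lin s phi psi c w :
  act s (fun v => phi v + c * psi v) w = act s phi w + c * act s psi w.
Proof.
by rewrite /act mulr_sumr -big_split; apply: eq_bigr => q _; rewrite mulrDr mulrCA.
Qed.

Lemma act0 s w : act s (fun=> 0) w = 0.
Proof. by apply: big1 => q _; rewrite mulr0. Qed.

Lemma eq_act s phi psi w : phi =1 psi -> act s phi w = act s psi w.
Proof. by move=> E; apply: eq_bigr => q _; rewrite E. Qed.

Lemma act_mesh s j Phi w : act s (mesh j Phi) w = mesh j (fun a => act s (Phi a)) w.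
Proof.
rewrite /act /mesh; under eq_bigr do rewrite mulr_sumr.
rewrite exchange_big /=; apply: eq_bigr => a _; rewrite mulr_sumr.
by apply: eq_bigr => q _; rewrite mulrCA.
Qed.

(** Leibniz rule: d(wu) = d(w)u for a cycle u, without sign because u stands on the right. *)
Lemma act_bdry s phi w : closed s -> act s (bdry phi) w = bdry (act s phi) w.
Proof.
move=> cs; elim: w phi => [|[p|j] w IHw] phi; first by rewrite cs bdry_nil.
  rewrite bdry_arrow -[RHS](IHw (after (inl p) phi)).
  by apply: eq_bigr => q _; rewrite bdry_arrow.
rewrite bdry_loop -(IHw (after (inr j) phi)).
have -> : mesh j (parts (act s phi) j) w = act s (mesh j (parts phi j)) w by rewrite act_mesh.
rewrite -actB.
by apply: eq_bigr => q _; rewrite /= bdry_loop.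
Qed.

Lemma eqon_act i nu H k0 s j l k phi psi : supported i nu H k0 s ->
  eqon i j (l + H) (k + k0) phi psi -> eqon nu j l k (act s phi) (act s psi).
Proof.
move=> hs E w hw; rewrite /act !big_seq; apply: eq_bigr => q /hs hq.
by rewrite E //; apply: word_cat hw hq.
Qed.

Lemma cocycle_act i nu H k0 s j l k phi : supported i nu H k0 s -> closed s ->
  cocycle i j (l + H) (k + k0) phi -> cocycle nu j l k (act s phi).
Proof.
move=> hs cs hphi w hw; rewrite -act_bdry //.
rewrite (eqon_act (psi := fun=> 0) hs _ hw) ?act0 // => v.
by rewrite addrAC; apply: hphi.
Qed.

(* Exactness of the mapping cone of act s, in terms of pairs (phi, psi). *)
Definition coneExact i nu H s j l k := forall phi psi,
  cocycle i j (l + H) k phi -> eqon nu j l (k - 1) (bdry psi) (act s phi) ->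
  exists phi' psi', eqon i j (l + H) k phi (bdry phi') /\
    eqon nu j l (k - 2) psi (fun w => act s phi' w - bdry psi' w).

(** Right multiplication leaves the leftmost letter alone, so it respects the fibre sequences. The
    argument is that of [exact_step] for pairs; [0 < l] and [0 <= H] keep the empty word out. *)
Lemma cone_step i nu H s j l k : supported i nu H 1 s -> closed s ->
  0 < l -> 0 <= H ->
  (forall a, e a j -> coneExact i nu H s a (l - 1) k) ->
  coneExact i nu H s j (l - 2) (k - 1) -> coneExact i nu H s j l k.
Proof.
move=> hs cs l0 H0 h1 h2 phi psi hphi hpsi.
have EH c : l + H - c = l - c + H by ring.
have [|Phi hPhi] := @choose_adj j (fun a phi' => exists psi',
    eqon i a (l - 1 + H) k (parts phi j a) (bdry phi') /\
    eqon nu a (l - 1) (k - 2) (parts psi j a) (fun w => act s phi' w - bdry psi' w)).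
  move=> a ea; apply: h1 => //; first by rewrite -EH; apply: cocycle_parts.
  move=> w hw; have hw' : word nu j l (k - 1) (inl (a, j) :: w).
    by rewrite word_arrow eqxx ea.
  by have := hpsi _ hw'; rewrite bdry_arrow.
have [//|Psi hPsi] := @choose_adj j (fun a psi' =>
    eqon i a (l - 1 + H) k (parts phi j a) (bdry (Phi a)) /\
    eqon nu a (l - 1) (k - 2) (parts psi j a) (fun w => act s (Phi a) w - bdry psi' w)).
(* The defects of the chosen families on loop words satisfy the cone condition on level l-2. *)
have [||phiL [psiL [E1 E2]]] := h2 (fun w => mesh j Phi w - after (inr j) phi w)
    (fun w => mesh j Psi w + after (inr j) psi w).
- rewrite -EH => w; rewrite subrK => hw.
  rewrite bdryB bdry_mesh -(cocycle_after_loop hphi hw).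
  apply/eqP; rewrite subr_eq0; apply/eqP; apply: (eq_mesh _ hw) => a v ea.
  rewrite EH (_ : l - 2 + H + 1 = l - 1 + H); last by ring.
  by case: (hPsi _ ea) => E _ /E.
- move=> w hw; have hw' : word nu j l (k - 1) (inr j :: w) by rewrite word_loop eqxx.
  have := hpsi _ hw'; rewrite bdry_loop => hL.
  rewrite actB -[act s (after _ _) w]/(act s phi (inr j :: w)) -hL act_mesh.
  transitivity (bdry (mesh j Psi) w + 1 * bdry (after (inr j) psi) w).
    by rewrite -bdry_lin; apply: eq_bigr => q _; rewrite mul1r.
  rewrite mul1r opprB addrA addrAC; congr (_ + _); rewrite bdry_mesh -meshB.
  apply: (eq_mesh _ hw) => a v ea.
  rewrite (_ : l - 2 + 1 = l - 1); last by ring.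
  rewrite (_ : k - 1 - 1 = k - 2); last by ring.
  by case: (hPsi _ ea) => _ E /E ->; rewrite opprB addrC subrK.
exists (glue Phi phiL), (glue Psi (fun w => - psiL w)); split.
  apply: bdry_glue => [|a ea|w hw].
  - by rewrite word_nil; apply/negP => /and3P[_ /eqP E _]; lia.
  - by rewrite EH; case: (hPsi _ ea).
  - by rewrite -E1 -?EH // opprB addrC subrK.
move=> [|[[a b]|b] w].
- by rewrite word_nil => /and3P[_ /eqP E _]; lia.
- rewrite word_arrow => /and3P[/eqP eb ea hw]; subst b.
  by case: (hPsi _ ea) => _ /(_ w hw); rewrite bdry_arrow.
- rewrite word_loop => /andP[/eqP eb hw]; subst b.
  have := E2 w; rewrite (_ : k - 1 - 2 = k - 2 - 1); last by ring.
  move=> /(_ hw) E; rewrite bdry_loop bdryN opprK.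
  rewrite opprD addrA addrAC -E.
  by rewrite [X in X - _]addrC addrK.
Qed.

(** * The Coxeter level and the periodicity cycle *)

Lemma exact_top i j k : exactAt i j h.+1 k.
Proof.
have [k0|] := ltrP 0 k; first exact: exact_low.
rewrite le_eqVlt => /predU1P[->|k0]; first exact: all_top.
by apply: exact_neg; rewrite k0 orbT.
Qed.

(** Level h+1 is exact, so cohomology on level h+2 comes from level h one degree lower, which lives
    only at nu in degree 0. *)
Lemma exact_coxeter i nu psi0 j k : isSocle i nu psi0 ->
  (j != nu) || (k != 1) -> exactAt i j h.+2 k.
Proof.
move=> [_ _ hj _] hk; apply: exact_step => [a _||].
- by rewrite predS; apply: exact_top.
- rewrite pred2S; have [k0|k0] := ltrP 0 (k - 1); first exact: exact_low.
  have [k1|nk] := eqVneq k 1; last by apply: exact_neg; lia.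
  by rewrite k1 subrr; apply: hj; move: hk; rewrite k1 eqxx orbF.
- by rewrite word_nil /= andbF.
Qed.

(** The one class left on level h+2: the socle generator read after a leading loop. *)
Definition zloop psi0 : seq (letter n) -> K := glue (fun _ _ => 0) psi0.

Lemma zloop_cocycle i nu psi0 : isSocle i nu psi0 -> cocycle i nu h.+2 1 (zloop psi0).
Proof.
case=> c0 _ _ _; apply: cocycle_glue => [a _|w]; first exact: cocycle_zero.
rewrite pred2S => hw; rewrite c0 //.
by apply: big1 => a _; rewrite mulr0.
Qed.

(** A functional separating [zloop psi0] from the coboundaries is, read as a list of coefficients,
    the cycle u of degree -1. *)
Lemma twist i nu psi0 : isSocle i nu psi0 -> exists s,
  [/\ supported i nu h.+2 1 s, closed s & act s (zloop psi0) [::] != 0].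
Proof.
move=> hsoc; have [c0 n0 _ _] := hsoc.
pose P p := exists phi, eqon i nu h.+2 1 p (bdry phi).
have [|||u hu uz] := @separating_functional _ _ (words i nu h.+2 1) P (zloop psi0) (words_uniq _ _ _ _).
- by exists (fun=> 0) => w _; rewrite bdry_zero.
- move=> p q c [phi hp] [psi hq]; exists (fun w => phi w + c * psi w) => w hw.
  by rewrite bdry_lin hp ?hq.
(* Were [zloop psi0] a coboundary, [psi0] would be the mesh of degree 0 cocycles on level h+1, which
   are zero. *)
- case=> p [phi hp] hz; apply: n0 => w hw.
  have E v : word i nu h.+2 1 v -> bdry phi v = zloop psi0 v.
    by move=> hv; rewrite -hz ?mem_words // hp.
  have /E : word i nu h.+2 1 (inr nu :: w) by rewrite word_loop eqxx pred2S.
  rewrite bdry_loop (bdry0 _ hw) subr0 /= => <-.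
  rewrite (eq_mesh (Psi := fun _ _ => 0) _ hw); first by apply: big1 => a _; rewrite mulr0.
  move=> a v ea; rewrite (_ : h%:Z + 1 = h.+1); last by lia.
  move=> hv; have [|psi Ep] := @exact_top i a 0 (parts phi nu a).
    move=> x hx; have /E : word i nu h.+2 1 (inl (a, nu) :: x).
      by rewrite word_arrow eqxx ea predS.
    by rewrite bdry_arrow.
  by rewrite Ep // (bdry0 _ hv).
exists [seq (u w, w) | w <- words i nu h.+2 1]; split.
- by move=> q /mapP[w]; rewrite mem_words => hw ->.
- by move=> phi; rewrite /act big_map; apply: hu; exists phi.
- by rewrite /act big_map.
Qed.

Lemma cone_base i nu psi0 s j k : isSocle i nu psi0 -> supported i nu h.+2 1 s ->
  closed s -> act s (zloop psi0) [::] != 0 -> coneExact i nu h.+2 s j 0 k.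
Proof.
move=> hsoc hs cs nz phi psi; rewrite add0r => hphi hpsi.
have [/andP[/eqP ej /eqP ek]|hjk] := boolP ((j == nu) && (k == 1)); last first.
  have [|phi0 E0] := exact_coxeter (k := k) hsoc _ hphi; first by rewrite -negb_and.
  have [/andP[/eqP ej /eqP ek]|hjk2] := boolP ((j == nu) && (k == 2)); last first.
    exists phi0, (fun=> 0); split=> // w /word_level0[_ ej ek].
    by case/negP: hjk2; rewrite -ej eqxx; lia.
  (* Degree 2 at nu: a multiple of the cocycle [zloop psi0] is added to the primitive to reach the
     value of [psi] at the empty word. *)
  subst j k; pose c := (psi [::] - act s phi0 [::]) / act s (zloop psi0) [::].
  exists (fun w => phi0 w + c * zloop psi0 w), (fun=> 0); split=> [w hw|w /word_level0[-> _ _]].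
    by rewrite bdry_lin (zloop_cocycle hsoc hw) mulr0 addr0 E0.
  by rewrite bdry_zero subr0 act_lin divfK // addrC subrK.
(* Degree 1 at nu: [phi] is a coboundary plus a multiple of [zloop psi0], and evaluating [act s phi]
   at the empty word shows that the multiple is zero. *)
subst j k; have [c0 _ _ hspan] := hsoc.
have [|Phi hPhi] := @choose_adj nu (fun a psi => eqon i a h.+1 1 (parts phi nu a) (bdry psi)).
  by move=> a ea; apply: exact_top; have := cocycle_parts hphi ea; rewrite predS.
have [|c hc] := hspan (fun w => mesh nu Phi w - after (inr nu) phi w).
  move=> w hw; rewrite bdryB bdry_mesh; have := cocycle_after_loop hphi (w := w).
  rewrite pred2S => <- //; apply/eqP; rewrite subr_eq0; apply/eqP.
  apply: (eq_mesh _ hw) => a v ea; rewrite (_ : h%:Z + 1 = h.+1); last by lia.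
  by move/(hPhi _ ea).
have E : eqon i nu h.+2 1 phi (fun w => bdry (glue Phi (fun=> 0)) w + (- c) * zloop psi0 w).
  move=> [|[[a b]|b] w]; first by rewrite word_nil /= andbF.
    rewrite word_arrow predS bdry_arrow => /and3P[/eqP eb ea hw]; subst b.
    by rewrite mulr0 addr0; apply: hPhi.
  rewrite word_loop pred2S bdry_loop => /andP[/eqP -> hw].
  by rewrite bdry_zero subr0 mulNr -hc // opprB addrC subrK.
have c_eq0 : c = 0.
  have hn : word nu nu 0 (1 - 1) [::] by rewrite word_nil !eqxx.
  have := hpsi _ hn; rewrite bdry_nil.
  rewrite (eqon_act (k := 0) (l := 0) hs E hn) act_lin act_bdry // bdry_nil add0r.
  by move/esym/eqP; rewrite mulf_eq0 (negPf nz) orbF oppr_eq0 => /eqP.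
exists (glue Phi (fun=> 0)), (fun=> 0); split=> [w hw|w /word_level0[_ _ //]].
by rewrite E // c_eq0 oppr0 mul0r addr0.
Qed.

Lemma cone_exact i nu psi0 s : isSocle i nu psi0 -> supported i nu h.+2 1 s ->
  closed s -> act s (zloop psi0) [::] != 0 ->
  forall (m : nat) j k, coneExact i nu h.+2 s j m k.
Proof.
move=> hsoc hs cs nz.
(* The induction starts at level -1, where the target has no words and the source, on level h+1, is
   exact. *)
have G : forall (m : nat) j k, coneExact i nu h.+2 s j (m%:Z - 1) k.
  elim/two_step => [j k phi psi|j k|m h0 h1 j k].
  - rewrite (_ : 0%:Z - 1 + h.+2 = h.+1); last by lia.
    move=> /exact_top[phi' E] _; exists phi', (fun=> 0); split=> // w /word_ge0[].
    by lia.
  - exact: cone_base hsoc hs cs nz.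
  - by rewrite predS; apply: cone_step.
by move=> m j k; have := G m.+1 j k; rewrite predS.
Qed.

Definition actInj i nu H k0 s := forall (m : nat) j k phi psi,
  cocycle i j (m + H)%N (k + k0) phi -> eqon nu j m k (act s phi) (bdry psi) ->
  exists phi', eqon i j (m + H)%N (k + k0) phi (bdry phi').

Definition actSurj i nu H k0 s := forall (m : nat) j k psi, cocycle nu j m k psi ->
  exists phi psi', cocycle i j (m + H)%N (k + k0) phi /\
    eqon nu j m k psi (fun w => act s phi w + bdry psi' w).

Lemma twist_quasi i nu psi0 : isSocle i nu psi0 -> exists s,
  [/\ supported i nu h.+2 1 s, closed s, actInj i nu h.+2 1 s & actSurj i nu h.+2 1 s].
Proof.
move=> hsoc; have [s [hs cs nz]] := twist hsoc; exists s.
have G := cone_exact hsoc hs cs nz; split=> // [m j k phi psi|m j k psi hpsi].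
  rewrite PoszD => hphi E; have [|phi' [psi' [E' _]]] := G m j _ phi psi hphi.
    by rewrite addrK => w /E.
  by exists phi'.
(* Surjectivity is the cone condition for [phi = 0], with [psi] any cocycle. *)
have [||phi' [psi' [E1 E2]]] := G m j (k + 2) (fun=> 0) psi.
- exact: cocycle_zero.
- move=> w; rewrite (_ : k + 2 - 1 = k + 1); last by ring.
  by move=> hw; rewrite act0 hpsi.
exists phi', (fun w => - psi' w); split=> [w|w].
  rewrite PoszD (_ : k + 1 + 1 = k + 2); last by ring.
  by move/E1.
by rewrite bdryN => hw; apply: E2; rewrite addrK.
Qed.

Definition actM (s2 s1 : seq (K * seq (letter n))) :=
  [seq (p.1 * q.1, p.2 ++ q.2) | p <- s2, q <- s1].

Lemma act_actM s2 s1 phi w : act (actM s2 s1) phi w = act s2 (act s1 phi) w.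
Proof.
rewrite /act big_allpairs_dep; apply: eq_bigr => p _; rewrite mulr_sumr.
by apply: eq_bigr => q _; rewrite mulrA catA.
Qed.

(** As nu is an involution, the cycles from i to nu and from nu to i multiply to one from i to i, of
    degree -2 and length 2(h+2). *)
Lemma periodic i : exists s,
  [/\ supported i i (h.+2 + h.+2)%N 2 s, closed s,
      actInj i i (h.+2 + h.+2) 2 s & actSurj i i (h.+2 + h.+2) 2 s].
Proof.
have [nu [psi hpsi]] := socle i; have [nu' [psi' hpsi']] := socle nu.
have e_i := socle_invol hpsi hpsi'; subst nu'.
have [s1 [hs1 cs1 inj1 surj1]] := twist_quasi hpsi.
have [s2 [hs2 cs2 inj2 surj2]] := twist_quasi hpsi'.
have two (k : int) : k + 2 = k + 1 + 1 by rewrite -addrA.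
exists (actM s2 s1); split.
- move=> q /allpairsP[[p r] [/hs2 hp /hs1 hr ->]] /=.
  by rewrite PoszD; apply: word_cat hp hr.
- move=> phi; rewrite act_actM -[RHS](cs2 (act s1 phi)); apply: eq_act => w.
  exact: act_bdry.
- move=> m j k phi psi1; rewrite addnA two => hphi E.
  have [||phi1 E1] := inj2 m j k (act s1 phi) psi1; last exact: inj1 hphi E1.
    by apply: cocycle_act hs1 cs1 _; rewrite -PoszD.
  by move=> w hw; rewrite -act_actM E.
- move=> m j k psi2 /surj2[phi2 [chi2 [c2 E2]]].
  have [phi1 [chi1 [c1 E1]]] := surj1 _ _ _ _ c2.
  exists phi1, (fun w => act s2 chi1 w + 1 * chi2 w); split.
    by rewrite addnA two.
  move=> w hw; rewrite E2 // act_actM bdry_lin mul1r addrA; congr (_ + _).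
  rewrite -act_bdry // -[X in _ = _ + X]mul1r -act_lin.
  by apply: (eqon_act hs2 _ hw) => v hv; rewrite E1 ?mul1r.
Qed.

End Period.

(** * Back to the Koszul complex *)

Lemma mx_evecP (B : seq (seq (letter n))) m1 (M N : 'M[K]_(m1, size B)) : uniq B ->
  (forall phi, M *m evec B phi = N *m evec B phi) -> M = N.
Proof.
move=> uB E; apply/matrixP => r c; have [phi hphi] := evec_surj (delta_mx c 0) uB.
by have := E phi; rewrite hphi -!colE => /colP/(_ r); rewrite !mxE.
Qed.

Lemma mem_Bdeg i j (l : nat) (p : int) w : (w \in Bdeg e i j l p) = word i j l (- p) w.
Proof.
rewrite /Bdeg; case: ifP => [p0|/negbT p0]; first by rewrite mem_basis -abszN gez0_abs // oppr_ge0.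
by apply/esym/negP => /word_ge0[_]; rewrite oppr_ge0; apply/negP.
Qed.

Lemma Bdeg_uniq i j (l : nat) (p : int) : uniq (Bdeg e i j l p).
Proof. by rewrite /Bdeg; case: ifP => // _; apply: basis_uniq. Qed.

Lemma evec_Bdeg i j (l : nat) (p : int) phi psi :
  evec (Bdeg e i j l p) phi = evec (Bdeg e i j l p) psi <-> eqon i j l (- p) phi psi.
Proof. by rewrite evec_eq; split=> E w; move: (E w); rewrite mem_Bdeg. Qed.

Lemma dmx_Bdeg i j (l : nat) (p p' : int) phi : p' = p + 1 ->
  dmx (Bdeg e i j l p) (Bdeg e i j l p') *m evec (Bdeg e i j l p') phi
  = evec (Bdeg e i j l p) (bdry phi).
Proof.
move=> ->; apply: dmx_evec => [|w q]; first exact: Bdeg_uniq.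
by rewrite !mem_Bdeg => hw hq; rewrite opprD; apply: mem_dterm hq hw.
Qed.

Definition amx s (B B' : seq (seq (letter n))) : 'M[K]_(size B, size B') :=
  \matrix_(r, c) act s (fun v => (v == nth [::] B' c)%:R) (nth [::] B r).

Lemma amx_evec s B B' phi : uniq B' ->
  (forall w q, w \in B -> q \in s -> w ++ q.2 \in B') ->
  amx s B B' *m evec B' phi = evec B (act s phi).
Proof.
move=> uB' hB; apply/colP => r; rewrite !mxE.
transitivity (\sum_(v <- B') act s (fun v' => (v' == v)%:R) (nth [::] B r) * phi v).
  by rewrite (big_nth [::]) big_mkord; apply: eq_bigr => c _; rewrite !mxE.
rewrite /act; under eq_bigr do rewrite mulr_suml.
rewrite exchange_big /= !big_seq; apply: eq_bigr => q hq.
have qB : nth [::] B r ++ q.2 \in B' by apply: hB; rewrite ?mem_nth.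
rewrite (bigD1_seq (nth [::] B r ++ q.2)) //= eqxx mulr1 big1 ?addr0 // => v nv.
by rewrite eq_sym (negPf nv) mulr0 mul0r.
Qed.

Lemma cd_shift2 i j (l : nat) (p : int) :
  cd (shift (Kcplx K e eps i j l) 2) p = dmx (Bdeg e i j l (p + 2)) (Bdeg e i j l (p + 1 + 2)).
Proof.
apply/matrixP => r c; rewrite mxE sqrrN expr1n mul1r castmxE !mxE /=.
congr (dcoef _ _ _ _ _).
exact: (congr1 (fun q => nth [::] (Bdeg e i j l q) (nat_of_ord c)) (addrAC p 2 1)).
Qed.

(** Duality exchanges the two halves: [actSurj] gives injectivity on the homology of the Koszul
    complex, and [actInj] gives surjectivity. *)
Lemma quasi_iso_act i j (l N : nat) s : supported i i N 2 s -> closed s ->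
  actInj i i N 2 s -> actSurj i i N 2 s ->
  quasi_iso (shift (Kcplx K e eps i j l) 2) (Kcplx K e eps i j (l + N)).
Proof.
move=> hs cs hinj hsurj.
pose f (p : int) : 'M[K]_(cdim (shift (Kcplx K e eps i j l) 2) p,
    cdim (Kcplx K e eps i j (l + N)) p) :=
  amx s (Bdeg e i j l (p + 2)) (Bdeg e i j (l + N) p).
have fE (p : int) phi : f p *m evec (Bdeg e i j (l + N) p) phi
    = evec (Bdeg e i j l (p + 2)) (act s phi).
  apply: amx_evec => [|w q]; first exact: Bdeg_uniq.
  rewrite !mem_Bdeg PoszD => hw /hs hq; have := word_cat hw hq.
  by rewrite opprD subrK.
have dE (p : int) phi : cd (Kcplx K e eps i j (l + N)) p *m evec (Bdeg e i j (l + N) (p + 1)) phi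
    = evec (Bdeg e i j (l + N) p) (bdry phi) by apply: dmx_Bdeg.
have dE' (p : int) phi : cd (shift (Kcplx K e eps i j l) 2) p *m evec (Bdeg e i j l (p + 1 + 2)) phi
    = evec (Bdeg e i j l (p + 2)) (bdry phi).
  by rewrite cd_shift2; apply: dmx_Bdeg; rewrite addrAC.
have e0 (p : int) (m : nat) phi : evec (Bdeg e i j m p) phi = 0 <-> eqon i j m (- p) phi (fun=> 0).
  by rewrite -(evec0 (Bdeg e i j m p)) evec_Bdeg.
exists f; split; last split.
- move=> p; apply: (mx_evecP (Bdeg_uniq i j (l + N) (p + 1))) => phi.
  rewrite -!mulmxA fE dE' dE fE; apply/evec_Bdeg => w _.
  by rewrite act_bdry.
- move=> p u hu /submxP[z hz]; apply: submx_cols => y.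
  have [psi <-] := evec_surj y (Bdeg_uniq i j l (p + 1 + 2)).
  rewrite dE' => /e0 hpsi.
  have [|phi [chi [hphi E]]] := hsurj l j (- (p + 1 + 2)) psi.
    by move=> w hw; apply: hpsi; move: hw; rewrite (_ : - (p + 1 + 2) + 1 = - (p + 2)) //; ring.
  rewrite (proj2 (evec_Bdeg _ _ _ _ _ _) E).
  have -> : evec (Bdeg e i j l (p + 1 + 2)) (fun w => act s phi w + bdry chi w)
      = evec (Bdeg e i j l (p + 1 + 2)) (act s phi) + evec (Bdeg e i j l (p + 1 + 2)) (bdry chi).
    by apply/colP => r; rewrite !mxE.
  rewrite mulmxDr -fE -dE' !mulmxA hu mul0mx addr0 hz -mulmxA dE.
  rewrite (proj2 (e0 _ _ _)) ?mulmx0 // => w hw; apply: hphi; move: hw.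
  by rewrite (_ : - (p + 1 + 2) + 2 + 1 = - p) //; ring.
- move=> p v hv.
  (* Surjectivity is membership of [v] in boundaries plus images of cycles, tested on the cochains
     annihilating both. *)
  suff /sub_addsmxP[[z1 z2] /= ->] : (v <= cd (Kcplx K e eps i j (l + N)) p
      + kermx (cd (shift (Kcplx K e eps i j l) 2) (p + 1)%R) *m f (p + 1)%R)%MS.
    exists (z2 *m kermx (cd (shift (Kcplx K e eps i j l) 2) (p + 1))); split.
      by rewrite -mulmxA mulmx_ker mulmx0.
    by rewrite mulmxA addrK submxMl.
  rewrite addsmxE; apply: submx_cols => y.
  rewrite mul_col_mx => /eqP; rewrite col_mx_eq0 => /andP[/eqP + /eqP].
  have [phi <-] := evec_surj y (Bdeg_uniq i j (l + N) (p + 1)).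
  rewrite -mulmxA fE dE => /e0 hphi /kermx_annihilator[z].
  have [psi <-] := evec_surj z (Bdeg_uniq i j l (p + 1 + 1 + 2)).
  rewrite dE' => /evec_Bdeg E.
  have k2 : - (p + 1 + 2) + 2 = - (p + 1) by ring.
  have [||phi' E'] := hinj l j (- (p + 1 + 2)) phi psi => //.
    by rewrite k2 => w hw; apply: hphi; move: hw; rewrite (_ : - (p + 1) + 1 = - p) //; ring.
  move: E'; rewrite k2 => E'.
  by rewrite (proj2 (evec_Bdeg _ _ _ _ _ _) E') -dE mulmxA hv mul0mx.
Qed.

End Words.

(** * Dynkin diagrams *)

Definition dyn_nbr (D : dynkin) (x y : nat) : bool := dyn_edge D x y || dyn_edge D y x.

(* A table of the nonnegative vectors U_t(C) e_0, t < h, certifying that U_(h-1)(C) e_0 is the first to vanish. *)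
Record chebTable (D : dynkin) (c : nat -> nat -> nat) : Prop := ChebTable {
  table0 : forall v, (v < dyn_rank D)%N -> c 0 v = (v == 0);
  table1 : forall v, (v < dyn_rank D)%N -> c 1 v = dyn_nbr D v 0;
  table_rec : forall t v, (t.+2 < coxeter D)%N -> (v < dyn_rank D)%N ->
    (c t.+2 v + c t v = \sum_(b < dyn_rank D | dyn_nbr D b v) c t.+1 b)%N;
  table_top : forall v, (v < dyn_rank D)%N -> c (coxeter D).-1 v = 0%N;
  table_neq0 : forall t, (t < (coxeter D).-1)%N ->
    exists2 v, (v < dyn_rank D)%N & c t v != 0%N }.

Lemma sum_neighbours (D : dynkin) (v : nat) (F : nat -> nat) (s : seq nat) :
  uniq s -> all (fun x => x < dyn_rank D)%N s ->
  (forall b, (b < dyn_rank D)%N -> dyn_nbr D b v = (b \in s)) ->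
  (\sum_(b < dyn_rank D | dyn_nbr D b v) F b = \sum_(x <- s) F x)%N.
Proof.
move=> us /allP hs hP; rewrite -(big_mkord (fun b => dyn_nbr D b v) F) -big_filter.
apply: perm_big; apply: uniq_perm => // [|x]; first by rewrite filter_uniq ?iota_uniq.
rewrite mem_filter mem_index_iota leq0n /=.
have [xr|xr] := ltnP x (dyn_rank D); first by rewrite hP // andbT.
by rewrite andbF; apply/esym/negP => /hs; rewrite ltnNge xr.
Qed.

(** The t-th vector is the unit vector at vertex t; it walks along the path and leaves it at t =
    h-1. *)
Lemma tableA m : chebTable (TA m) (fun t v => (v == t :> nat)).
Proof.
split=> [//|v|t v ht hv|v|t]; last 2 first.
- by move=> /= ?; lia.
- by move=> ?; exists t; rewrite ?eqxx.
- by rewrite /dyn_nbr /=.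
pose s := (if v is v'.+1 then [:: v'] else [::]) ++ (if (v < m)%N then [:: v.+1] else [::]).
rewrite (@sum_neighbours _ v (fun v => (v == t.+1 :> nat)) s) {}/s; move: ht hv => /= ht hv.
- by case: v hv => [|v] hv; case: ifP => hm; rewrite /= ?big_cons ?big_nil; lia.
- by case: v {hv} => [|v]; case: ifP => //= _; rewrite inE; lia.
- by case: v hv => [|v] hv; case: ifP => //= hm; lia.
- move=> b hb; rewrite /dyn_nbr.
  case: v hv => [|v] hv; case: ifP => hm; rewrite /= ?inE; apply/idP/idP; lia.
Qed.

(** A unit vector runs from vertex 0 to the branch vertex m+1, fills both leaves m+2 and m+3 at t =
    m+2, then runs back and reaches 0 at t = 2m+4 = h-2. *)
Definition tabD (m t v : nat) : nat :=
  if (v == m + 3)%N then (t == m + 2)%N else ((v == t) || (v + t == 2 * m + 4))%N.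

Lemma tableD m : chebTable (TD m) (tabD m).
Proof.
split=> [v|v|t v ht hv|v|t]; rewrite /= ?/dyn_nbr /=.
- by rewrite /tabD; case: ifP => h1 h2; lia.
- by rewrite /tabD; case: ifP => h1 h2; lia.
- move: ht hv => /= ht hv.
  have [v3|v3] := eqVneq v (m + 3)%N.
    rewrite (@sum_neighbours (TD m) v (tabD m t.+1) [:: (m + 1)%N]) //=; last 2 first.
    - lia.
    - by move=> b hb; rewrite inE /dyn_nbr /=; apply/idP/idP; lia.
    by rewrite big_seq1 /tabD; repeat case: ifP; lia.
  pose s := (if v is v'.+1 then [:: v'] else [::])
     ++ (if v == (m + 2)%N then [::] else if v == (m + 1)%N then [:: (m + 2)%N; (m + 3)%N]
         else [:: v.+1]).
  rewrite (@sum_neighbours (TD m) v (tabD m t.+1) s) {}/s /=.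
  + case: v hv v3 => [|v] hv v3; case: ifP => h1; try case: ifP => h2;
      rewrite /= ?big_cons ?big_nil /tabD; repeat (case: ifP => ?); lia.
  + case: v {hv v3} => [|v]; case: ifP => h1 //; try case: ifP => h2 //;
      rewrite /= ?inE; lia.
  + case: v hv v3 => [|v] hv v3; case: ifP => h1 //; try case: ifP => h2 //;
      rewrite /=; lia.
  + move=> b hb; rewrite /dyn_nbr /=.
    case: v hv v3 => [|v] hv v3; case: ifP => h1; try case: ifP => h2;
      rewrite /= ?inE; apply/idP/idP; lia.
- by rewrite /tabD; case: ifP => h1 h2; lia.
- move=> ht; have [t2|t2] := leqP t (m + 2).
    by exists t; [lia | rewrite /tabD; case: ifP; lia].
  by exists (2 * m + 4 - t)%N; [lia | rewrite /tabD; case: ifP; lia].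
Qed.

Definition table_rows (D : dynkin) : seq (seq nat) :=
  let r := dyn_rank D in
  let fix rows (t : nat) (p c : seq nat) :=
    p :: (if t is t'.+1 then
      rows t' c [seq (sumn [seq nth 0 c b | b <- iota 0 r & dyn_nbr D b v] - nth 0 p v)%N
                | v <- iota 0 r]
    else [::]) in
  rows (coxeter D).-1 [seq (v == 0 : nat) | v <- iota 0 r] [seq (dyn_nbr D v 0 : nat) | v <- iota 0 r].

(** The rows are computed with truncated subtraction; checking the recursion in additive form rules
    out any truncation error. *)
Definition table_check (D : dynkin) : bool :=
  let r := dyn_rank D in let h := coxeter D in
  let T := table_rows D in
  let c t v := nth 0%N (nth [::] T t) v in
  [&& all (fun v => c 0 v == (v == 0)) (iota 0 r),
      all (fun v => c 1 v == dyn_nbr D v 0) (iota 0 r),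
      all (fun t => all (fun v => c t.+2 v + c t v
          == sumn [seq c t.+1 b | b <- iota 0 r & dyn_nbr D b v])%N (iota 0 r)) (iota 0 (h - 2)),
      all (fun v => c h.-1 v == 0%N) (iota 0 r) &
      all (fun t => has (fun v => c t v != 0%N) (iota 0 r)) (iota 0 h.-1)].

Lemma table_checkP D : table_check D ->
  chebTable D (fun t v => nth 0%N (nth [::] (table_rows D) t) v).
Proof.
case/and5P=> /allP h0 /allP h1 /allP h2 /allP h3 /allP h4.
have inr v : (v < dyn_rank D)%N -> v \in iota 0 (dyn_rank D) by rewrite mem_iota.
split=> [v /inr /h0 /eqP //|v /inr /h1 /eqP //|t v ht hv|v /inr /h3 /eqP //|t ht].
- have /h2/allP : t \in iota 0 (coxeter D - 2) by rewrite mem_iota add0n leq0n /= ltn_subRL.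
  move=> /(_ v (inr v hv))/eqP ->.
  by rewrite sumnE big_map big_filter -(big_mkord (fun b => dyn_nbr D b v)) /index_iota subn0.
- have /h4/hasP[v] : t \in iota 0 (coxeter D).-1 by rewrite mem_iota.
  by rewrite mem_iota => hv nz; exists v.
Qed.

Lemma tableE6 : table_check TE6. Proof. by vm_compute. Qed.
Lemma tableE7 : table_check TE7. Proof. by vm_compute. Qed.
Lemma tableE8 : table_check TE8. Proof. by vm_compute. Qed.

Lemma table_exists D : exists c, chebTable D c.
Proof.
case: D => [m|m|||]; last 3 first.
- by eexists; apply: table_checkP tableE6.
- by eexists; apply: table_checkP tableE7.
- by eexists; apply: table_checkP tableE8.
- by eexists; apply: tableA.
- by eexists; apply: tableD.
Qed.

Lemma dyn_parent D y : (0 < y < dyn_rank D)%N -> exists2 z, (z < y)%N & dyn_edge D z y.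
Proof.
case: D => [m|m|||] /= hy.
- by exists y.-1; lia.
- by have [->|ny] := eqVneq y (m + 3)%N; [exists (m + 1)%N | exists y.-1]; lia.
- by have [->|ny] := eqVneq y 5%N; [exists 2%N | exists y.-1]; lia.
- by have [->|ny] := eqVneq y 6%N; [exists 2%N | exists y.-1]; lia.
- by have [->|ny] := eqVneq y 7%N; [exists 2%N | exists y.-1]; lia.
Qed.

Lemma dyn_connected D (Q : 'I_(dyn_rank D) -> Prop) :
  (forall x y, dyn_adj D x y -> Q x -> Q y) -> forall x y, Q x -> Q y.
Proof.
move=> hQ.
have r0 : (0 < dyn_rank D)%N by case: D {Q hQ} => //= m; rewrite addnS.
pose z0 := Ordinal r0.
have to0 : forall x, Q x <-> Q z0.
  move=> x; have [m] := ubnP (x : nat); elim: m x => // m IHm x hm.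
  have [x0|x0] := posnP (x : nat); first by have -> : x = z0 by apply: val_inj.
  have [|z zx ez] := @dyn_parent D x; first by rewrite x0 ltn_ord.
  have zr : (z < dyn_rank D)%N by apply: ltn_trans zx (ltn_ord x).
  have -> : Q x <-> Q (Ordinal zr).
    by split; apply: hQ; rewrite /dyn_adj /= ez ?orbT.
  by apply: IHm; apply: leq_trans zx _.
by move=> x y /to0 hx; apply/to0.
Qed.

Section Labelling.
Variables (n : nat) (e : rel 'I_n) (D : dynkin) (sigma : 'I_n -> 'I_(dyn_rank D)).
Hypothesis sigma_bij : bijective sigma.
Hypothesis eE : forall x y : 'I_n, e x y = dyn_adj D (sigma x) (sigma y).

Lemma dyn_sym : symmetric e.
Proof. by move=> x y; rewrite !eE /dyn_adj orbC. Qed.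

Lemma chebU_table c o : chebTable D c -> sigma o = 0%N :> nat ->
  forall m j, (m < coxeter D)%N -> chebU e m j o = (c m (sigma j))%:Z.
Proof.
move=> [c0 c1 crec _ _] so.
have eqo j : (j == o) = (sigma j == 0%N :> nat).
  by rewrite -so val_eqE (bij_eq sigma_bij).
elim/two_step => [j _|j _|m h0 h1 j hm].
- by rewrite c0 // mxE eqo; case: eqP.
- by rewrite c1 // mxE eE /dyn_adj so.
rewrite chebUSS mxE [X in _ + X]mxE h0; last by apply: ltn_trans hm; apply: ltnW.
have := crec m (sigma j) hm (ltn_ord _); have [tau st ts] := sigma_bij.
rewrite (reindex sigma); last by exists tau => x _.
move/(congr1 Posz); rewrite PoszD => /(canRL (addrK _)) ->.
rewrite (big_morph Posz PoszD (erefl _)) [in RHS]big_mkcond mxE; congr (_ - _).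
apply: eq_bigr => a _; rewrite mxE h1; last by apply: ltn_trans hm.
rewrite eE /dyn_adj /dyn_nbr [in RHS]orbC.
by case: (_ || _); rewrite ?mul1r ?mul0r.
Qed.

Lemma adj_connected a b : exists p, (adjm e ^+ p) a b != 0.
Proof.
have [tau st ts] := sigma_bij.
pose Q x := exists p, (adjm e ^+ p) (tau x) b != 0.
rewrite -(st a); apply: (@dyn_connected D Q _ (sigma b)); last first.
  by exists 0%N; rewrite st expr0 mxE eqxx.
(* Powers of C are entrywise nonnegative, so prolonging a walk by an edge cannot be cancelled. *)
move=> x y xy [p np]; exists p.+1; rewrite exprS mxE (bigD1 (tau x)) //=.
rewrite mxE eE !ts /dyn_adj orbC -/(dyn_adj D x y) xy mul1r lt0r_neq0 //.
apply: ltr_wpDr; last by rewrite lt0r np adjmX_ge0.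
by apply: sumr_ge0 => c _; rewrite mulr_ge0 ?adjmX_ge0 // mxE.
Qed.

End Labelling.

Theorem mainTheorem12 (K : fieldType) (n : nat) (e : rel 'I_n)
    (eps : 'I_n -> 'I_n -> bool) (D : dynkin) (sigma : 'I_n -> 'I_(dyn_rank D)) :
  bijective sigma ->
  (forall x y : 'I_n, e x y = dyn_adj D (sigma x) (sigma y)) ->
  (forall x y : 'I_n, e x y -> eps x y = ~~ eps y x) ->
  forall (i j : 'I_n) (l : nat),
    quasi_iso (shift (Kcplx K e eps i j l) 2)
              (Kcplx K e eps i j (l + 2 * coxeter D)%N).
Proof.
move=> sb eE _ i j l; have esym := dyn_sym eE.
have [c hc] := table_exists D.
have r0 : (0 < dyn_rank D)%N by case: (D) => //= m; rewrite addnS.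
have [tau st ts] := sb; pose o := tau (Ordinal r0).
have so : sigma o = 0%N :> nat by rewrite /o ts.
have U := chebU_table sb eE hc so.
have [h Eh] : exists h, coxeter D = h.+2.
  by exists (coxeter D - 2)%N; case: (D) => //= m; lia.
have [_ _ _ ctop cneq] := hc; rewrite Eh /= in ctop cneq U.
have [m hm|k|s [h1 h2 h3 h4]] := @periodic n e esym K eps h o _ _ (adj_connected sb eE) i.
- have [v vr nz] := cneq m hm; exists (tau (Ordinal vr)).
  by rewrite U ?ts //; apply: ltnW.
- by rewrite U // ctop.
by rewrite mul2n -addnn Eh; apply: quasi_iso_act h1 h2 h3 h4.
Qed.
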